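(* Let $p$ be a prime and let $\mathcal{L}_p$ be a $p$-adic self-similar string with scaling ratios $r_j=p^{-n_j}$ ($n_j\in\mathbb{N}^*$, $j=1,\dots,N$) and gaps $g_k=\mu_H(G_k)=p^{-m_k}$ ($m_k\in\mathbb{N}^*$, $k=1,\dots,K$). Let $d=\gcd\{n_1,\dots,n_N,m_1,\dots,m_K\}$, write $n_j=d\,n_j'$ and $m_k=d\,m_k'$ with $n_j',m_k'\in\mathbb{N}^*$, and put $r=p^{-d}$ and $z=r^s$. Then the geometric zeta function $\zeta_{\mathcal{L}_p}$ (meromorphically continued to $\mathbb{C}$) is a rational function of $z$; specifically, $$\zeta_{\mathcal{L}_p}(s)=\frac{\sum_{k=1}^{K}z^{m_k'}}{1-\sum_{j=1}^{N}z^{n_j'}}.$$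
   Context: $\mathbb{N}^*=\{1,2,3,\dots\}$. $|\cdot|_p$ is normalized by $|p^k|_p=p^{-k}$, and $\mu_H$ is Haar measure on $\mathbb{Q}_p$ with $\mu_H(\mathbb{Z}_p)=1$. An affine similarity contraction mapping of $\mathbb{Z}_p$ is a map $\Phi:\mathbb{Z}_p\to\mathbb{Z}_p$, $\Phi(x)=ax+b$ with $a,b\in\mathbb{Z}_p$, for which there is $r\in(0,1)$ (its scaling ratio) with $|\Phi(x)-\Phi(y)|_p=r|x-y|_p$ for all $x,y\in\mathbb{Z}_p$; necessarily $r=|a|_p=p^{-n}$ for some $n\in\mathbb{N}^*$. A $p$-adic self-similar string is built as follows. Let $N\ge2$ and let $\Phi_1,\dots,\Phi_N$ be affine similarity contraction mappings of $\mathbb{Z}_p$ with scaling ratios $1>r_1\ge\cdots\ge r_N>0$, such that $\sum_{j=1}^N r_j<1$ and the images $\Phi_j(\mathbb{Z}_p)$ are pairwise disjoint. Let $G_1,\dots,G_K$ ($K\ge1$) be the generators, i.e. the convex components (maximal balls contained in the set) of $\mathbb{Z}_p\setminus\bigcup_{j=1}^N\Phi_j(\mathbb{Z}_p)$, with lengths (gaps) $g_k=\mu_H(G_k)$, $1>g_1\ge\cdots\ge g_K>0$. The associated $p$-adic self-similar string is the disjoint union of balls $\mathcal{L}_p=\bigcup_{w}\bigcup_{k=1}^K\Phi_w(G_k)$, where $w$ runs over all finite words (including the empty word) on $\{1,\dots,N\}$ and $\Phi_w=\Phi_{w_\alpha}\circ\cdots\circ\Phi_{w_1}$ for $w=(w_1,\dots,w_\alpha)$.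 The geometric zeta function of $\mathcal{L}_p$ is initially defined, for $\Re(s)$ sufficiently large, by $\zeta_{\mathcal{L}_p}(s)=\sum_{B}\mu_H(B)^s$, the sum being over the balls $B$ that are the convex components (maximal balls) of the open set $\mathcal{L}_p$, which are exactly the balls $\Phi_w(G_k)$; it is then identified with its meromorphic continuation to $\mathbb{C}$. *)

(* Defs.v *)
From HB Require Import structures.
From mathcomp Require Import all_boot all_order all_algebra.
From mathcomp Require Import fraction finmap.
From mathcomp Require Import all_classical all_reals all_analysis.
From mathcomp Require Import summability complex.

Set Implicit Arguments.
Unset Strict Implicit.
Unset Printing Implicit Defensive.

Import numFieldNormedType.Exports.
Import Order.TTheory GRing.Theory Num.Theory.

Local Open Scope classical_set_scope.
Local Open Scope ring_scope.

(* Z_p is the inverse limit of the rings Z/p^n: an element is a coherent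
   sequence of residues, x n in {0, ..., p^n - 1}. *)
Record padic_int (p : nat) (p_pr : prime p) := PadicInt {
  residue :> nat -> nat;
  residue_coherent : forall n, residue n = (residue n.+1 %% p ^ n)%N }.

HB.instance Definition _ p (p_pr : prime p) := gen_eqMixin (padic_int p_pr).
HB.instance Definition _ p (p_pr : prime p) := gen_choiceMixin (padic_int p_pr).

Section PadicIntegers.
Variables (p : nat) (p_pr : prime p).
Local Notation Zp := (padic_int p_pr).
Implicit Types x y z : Zp.

Let p_gt0 : (0 < p)%N. Proof. exact: prime_gt0. Qed.
Let pX_gt0 n : (0 < p ^ n)%N. Proof. by rewrite expn_gt0 p_gt0. Qed.
Let pXS n : (p ^ n %| p ^ n.+1)%N. Proof. by rewrite dvdn_exp2l. Qed.

Lemma padic_int_eq x y : residue x =1 residue y -> x = y.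
Proof.
case: x y => [x hx] [y hy] /= /funext exy; case: _ / exy hy => hy.
by congr PadicInt; exact: Prop_irrelevance.
Qed.

Lemma residue_mod x n : (x n %% p ^ n = x n)%N.
Proof. by rewrite (residue_coherent x n) modn_mod. Qed.

Lemma residue_le x m n : (m <= n)%N -> x m = (x n %% p ^ m)%N.
Proof.
elim: n => [|n IHn]; first by rewrite leqn0 => /eqP ->; rewrite residue_mod.
rewrite leq_eqVlt ltnS => /predU1P[->|lemn]; first by rewrite residue_mod.
by rewrite IHn // residue_coherent modn_dvdm // dvdn_exp2l.
Qed.

Fact limit_subproof (f : nat -> nat) :
  (forall n, f n.+1 = f n %[mod p ^ n])%N ->
  forall n, (f n %% p ^ n = f n.+1 %% p ^ n.+1 %% p ^ n)%N.
Proof. by move=> hf n; rewrite modn_dvdm // hf. Qed.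

Definition padic_limit f hf : Zp := PadicInt p_pr (@limit_subproof f hf).

Fact const_subproof k n : (k = k %[mod p ^ n])%N. Proof. by []. Qed.
Definition padic_nat k : Zp := padic_limit (const_subproof k).

Fact add_subproof x y n : (x n.+1 + y n.+1 = x n + y n %[mod p ^ n])%N.
Proof. by rewrite (residue_coherent x n) (residue_coherent y n) modnDm. Qed.
Definition padic_add x y : Zp := padic_limit (add_subproof x y).

Fact mul_subproof x y n : (x n.+1 * y n.+1 = x n * y n %[mod p ^ n])%N.
Proof. by rewrite (residue_coherent x n) (residue_coherent y n) modnMm. Qed.
Definition padic_mul x y : Zp := padic_limit (mul_subproof x y).

Let residue_ltn x n : (x n < p ^ n)%N.
Proof. by rewrite -residue_mod ltn_mod. Qed.

Fact opp_subproof x n :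
  (p ^ n.+1 - x n.+1 = p ^ n - x n %[mod p ^ n])%N.
Proof.
apply/eqP; rewrite -(eqn_modDr (x n.+1)) subnK; last exact/ltnW/residue_ltn.
rewrite -modnDmr -residue_coherent subnK; last exact/ltnW/residue_ltn.
by rewrite modnn; apply: pXS.
Qed.
Definition padic_opp x : Zp := padic_limit (opp_subproof x).

Fact padic_addA : associative padic_add.
Proof.
by move=> x y z; apply: padic_int_eq => n /=; rewrite modnDml modnDmr addnA.
Qed.
Fact padic_addC : commutative padic_add.
Proof. by move=> x y; apply: padic_int_eq => n /=; rewrite addnC. Qed.
Fact padic_add0 : left_id (padic_nat 0) padic_add.
Proof.
by move=> x; apply: padic_int_eq => n /=; rewrite mod0n add0n residue_mod.
Qed.
Fact padic_addN : left_inverse (padic_nat 0) padic_opp padic_add.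
Proof.
move=> x; apply: padic_int_eq => n /=.
by rewrite modnDml subnK ?modnn ?mod0n //; exact/ltnW/residue_ltn.
Qed.

HB.instance Definition _ :=
  GRing.isZmodule.Build Zp padic_addA padic_addC padic_add0 padic_addN.

Fact padic_mulA : associative padic_mul.
Proof.
by move=> x y z; apply: padic_int_eq => n /=; rewrite modnMml modnMmr mulnA.
Qed.
Fact padic_mulC : commutative padic_mul.
Proof. by move=> x y; apply: padic_int_eq => n /=; rewrite mulnC. Qed.
Fact padic_mul1 : left_id (padic_nat 1) padic_mul.
Proof.
by move=> x; apply: padic_int_eq => n /=; rewrite modnMml mul1n residue_mod.
Qed.
Fact padic_mulDl : left_distributive padic_mul padic_add.
Proof.
move=> x y z; apply: padic_int_eq => n /=.
by rewrite modnMml modnDml modnDmr mulnDl.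
Qed.
Fact padic_1neq0 : padic_nat 1 != 0.
Proof.
apply/eqP => /(congr1 (fun x : Zp => x 1%N)) /=.
by rewrite mod0n modn_small // expn1 prime_gt1.
Qed.

HB.instance Definition _ := GRing.Zmodule_isComNzRing.Build Zp
  padic_mulA padic_mulC padic_mul1 padic_mulDl padic_1neq0.

Lemma residue0 n : (0 : Zp) n = 0%N. Proof. exact: mod0n. Qed.

(* The exponent of p in x; the value at x = 0 is irrelevant. *)
Definition valuation x : nat := xget 0%N [set n | x n = 0%N /\ x n.+1 <> 0%N].

Lemma valuationP x : x != 0 ->
  x (valuation x) = 0%N /\ x (valuation x).+1 <> 0%N.
Proof.
move=> x_neq0; rewrite /valuation; case: xgetP => [n _ [] //|noval].
case/eqP: x_neq0; apply: padic_int_eq => n; rewrite residue0.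
elim: n => [|n IHn]; first by rewrite -residue_mod expn0 modn1.
by apply: contrapT => xn1; apply: (noval n).
Qed.

Lemma logn_residue x n : x != 0 -> (valuation x < n)%N ->
  x n <> 0%N /\ logn p (x n) = valuation x.
Proof.
move=> /valuationP[xv xv1] ltvn.
have xn : x n <> 0%N by move=> xn; case: xv1; rewrite (residue_le x ltvn) xn mod0n.
split=> //; apply/eqP; rewrite eqn_leq; apply/andP; split.
  rewrite leqNgt -pfactor_dvdn //; last by rewrite lt0n; apply/eqP.
  by apply/negP => /eqP; rewrite -(residue_le x ltvn).
rewrite -pfactor_dvdn //; last by rewrite lt0n; apply/eqP.
by apply/eqP; rewrite -(residue_le x (ltnW ltvn)).
Qed.

Lemma valuation_unique x n : x n = 0%N -> x n.+1 <> 0%N -> valuation x = n.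
Proof.
move=> xn xn1; have x_neq0 : x != 0.
  by apply/eqP => x0; case: xn1; rewrite x0 residue0.
have [xv xv1] := valuationP x_neq0.
case: (ltngtP (valuation x) n) => // [ltvn|ltnv].
  by case: xv1; rewrite (residue_le x ltvn) xn mod0n.
by case: xn1; rewrite (residue_le x ltnv) xv mod0n.
Qed.

Lemma valuationM x y : x != 0 -> y != 0 ->
  x * y != 0 /\ valuation (x * y) = (valuation x + valuation y)%N.
Proof.
move=> x0 y0; set v := (valuation x + valuation y)%N.
have ltx : (valuation x < v.+1)%N by rewrite ltnS leq_addr.
have lty : (valuation y < v.+1)%N by rewrite ltnS leq_addl.
have [/eqP xn lx] := logn_residue x0 ltx.
have [/eqP yn ly] := logn_residue y0 lty.
have lxy : logn p (x v.+1 * y v.+1) = v by rewrite lognM ?lt0n // lx ly.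
have xy_gt0 : (0 < x v.+1 * y v.+1)%N by rewrite muln_gt0 !lt0n xn.
have xyv1 : (x * y : Zp) v.+1 <> 0%N.
  by move=> /= /eqP; rewrite -/(dvdn _ _) pfactor_dvdn // lxy ltnn.
have xyv : (x * y : Zp) v = 0%N.
  rewrite (residue_coherent (x * y) v) /= modn_dvdm //.
  by apply/eqP; rewrite -/(dvdn _ _) pfactor_dvdn // lxy.
split; last exact: valuation_unique.
by apply/eqP => xy0; case: xyv1; rewrite xy0 residue0.
Qed.

Definition padic_unit : pred Zp := fun x => `[< exists y : Zp, y * x = 1 >].
Definition padic_inv x : Zp :=
  if padic_unit x then xget 0 [set y : Zp | y * x = 1] else x.

Fact padic_mulV : {in padic_unit, left_inverse 1 padic_inv *%R}.
Proof.
move=> x; rewrite -[x \in _]/(padic_unit x) /padic_inv => ux; rewrite ux.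
by case: xgetP => [y _ //|nox]; case/asboolP: ux => y /nox.
Qed.
Fact padic_unitPl (x y : Zp) : y * x = 1 -> padic_unit x.
Proof. by move=> yx; apply/asboolP; exists y. Qed.
Fact padic_inv_out : {in [predC padic_unit], padic_inv =1 id}.
Proof.
by move=> x; rewrite -[x \in _]/(~~ padic_unit x) /padic_inv => /negbTE ->.
Qed.

HB.instance Definition _ := GRing.ComNzRing_hasMulInverse.Build Zp
  padic_mulV padic_unitPl padic_inv_out.

Fact padic_mulf_eq0 x y : x * y = 0 -> (x == 0) || (y == 0).
Proof.
move=> xy0; apply/negPn; rewrite negb_or; apply/negP => /andP[x0 y0].
by have [] := valuationM x0 y0; rewrite xy0 eqxx.
Qed.

HB.instance Definition _ :=
  GRing.ComUnitRing_isIntegral.Build Zp padic_mulf_eq0.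

End PadicIntegers.

Arguments valuation {p p_pr} x.

Definition padic (p : nat) (p_pr : prime p) := {fraction (padic_int p_pr)}.

HB.instance Definition _ p (p_pr : prime p) := GRing.Field.on (padic p_pr).
HB.instance Definition _ p (p_pr : prime p) := isPointed.Build (padic p_pr) 0.

Section PadicNumbers.
Variables (R : realType) (p : nat) (p_pr : prime p).
Local Notation Zp := (padic_int p_pr).
Local Notation Qp := (padic p_pr).

Definition padic_int_abs (x : Zp) : R :=
  if x == 0 then 0 else p%:R ^- valuation x.

(* The absolute value of a fraction is read off any representative. *)
Definition padic_abs (x : Qp) : R :=
  padic_int_abs ((repr x).1) / padic_int_abs ((repr x).2).

Lemma padic_int_absM (x y : Zp) :
  padic_int_abs (x * y) = padic_int_abs x * padic_int_abs y.
Proof.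
rewrite /padic_int_abs mulf_eq0.
have [//|x0] := eqVneq x 0; first by rewrite mul0r.
have [//|y0] /= := eqVneq y 0; first by rewrite mulr0.
by have [_ ->] := valuationM x0 y0; rewrite exprD invfM.
Qed.

Lemma padic_absE (x y : Zp) : y != 0 ->
  padic_abs (tofrac x / tofrac y) = padic_int_abs x / padic_int_abs y.
Proof.
have abs_neq0 (u : Zp) : u != 0 -> padic_int_abs u != 0.
  move=> /negbTE u0; rewrite /padic_int_abs u0 invr_eq0 expf_neq0 //.
  by rewrite pnatr_eq0 -lt0n prime_gt0.
move=> y0; rewrite /padic_abs.
set f := repr _; have fE : tofrac x / tofrac y = tofrac f.1 / tofrac f.2.
  rewrite -[LHS]reprK -/f; unlock tofrac.
  rewrite -[X in _ * X]FracField.pi_inv -[RHS]FracField.pi_mul.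
  rewrite /FracField.invf /FracField.mulf !numden_Ratio ?oner_neq0 ?mul1r ?denom_ratioP //.
  by rewrite mulr1 Ratio_numden.
have d0 : f.2 != 0 := denom_ratioP f.
have ny : tofrac y != 0 by rewrite tofrac_eq0.
have nd : tofrac f.2 != 0 by rewrite tofrac_eq0.
move/eqP: fE; rewrite eqr_div // -!tofracM tofrac_eq => /eqP fE.
by apply/eqP; rewrite eqr_div ?abs_neq0 // -!padic_int_absM fE.
Qed.

Definition padic_ball (a : Qp) (e : R) : set Qp :=
  [set x | padic_abs (x - a) <= e].

(* Z_p as a subset of Q_p. *)
Definition padic_unit_ball : set Qp := padic_ball 0 1.

(* The value group of Q_p is p^Z, so these are all the balls of Q_p. *)
Definition is_padic_ball (B : set Qp) : Prop :=
  exists (a : Qp) (n : int), B = padic_ball a (p%:R ^ n).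

Definition padic_open : set (set Qp) :=
  [set U | forall x, U x -> exists2 e : R, 0 < e & padic_ball x e `<=` U].

Definition padic_borel := g_sigma_algebraType padic_open.

(* Translation invariance together with mu(Z_p) = 1 characterizes the
   normalized Haar measure among the Borel measures on Q_p. *)
Definition normalized_haar (mu : {measure set padic_borel -> \bar R}) : Prop :=
  (forall (a : Qp) (A : set padic_borel), measurable A ->
     mu [set a + x | x in (A : set Qp)] = mu A) /\
  mu padic_unit_ball = 1%:E.

Definition convex_components (A : set Qp) : set (set Qp) :=
  [set B | [/\ is_padic_ball B, B `<=` A &
     forall B', is_padic_ball B' -> B `<=` B' -> B' `<=` A -> B' = B]].

Definition affine_similarity_contraction (Phi : Qp -> Qp) (r : R) : Prop :=
  [/\ exists a b, [/\ padic_unit_ball a, padic_unit_ball b &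
        forall x, padic_unit_ball x -> Phi x = a * x + b],
      0 < r < 1 &
      forall x y, padic_unit_ball x -> padic_unit_ball y ->
        padic_abs (Phi x - Phi y) = r * padic_abs (x - y)].

(* Only the restrictions to Z_p of the maps Phi j are relevant. *)
Record self_similar_system (mu : {measure set padic_borel -> \bar R})
    (N K : nat) (Phi : 'I_N -> Qp -> Qp) (r : 'I_N -> R)
    (G : 'I_K -> set Qp) (g : 'I_K -> R) : Prop := SelfSimilarSystem {
  system_N : (2 <= N)%N;
  system_map : forall j, affine_similarity_contraction (Phi j) (r j);
  system_ratio_sorted : forall i j : 'I_N, (i <= j)%N -> r j <= r i;
  system_ratio_sum : \sum_(j < N) r j < 1;
  system_disjoint : trivIset setT (fun j => Phi j @` padic_unit_ball);
  system_K : (1 <= K)%N;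
  system_gen_inj : injective G;
  system_gen : range G = convex_components
    (padic_unit_ball `\` \bigcup_(j in [set: 'I_N]) (Phi j @` padic_unit_ball));
  system_gap : forall k, mu (G k) = (g k)%:E;
  system_gap_bounds : forall k, 0 < g k < 1;
  system_gap_sorted : forall i j : 'I_K, (i <= j)%N -> g j <= g i }.

(* The composite Phi_(w_a) o ... o Phi_(w_1) for w = (w_1, ..., w_a). *)
Definition word_map (N : nat) (Phi : 'I_N -> Qp -> Qp) (w : seq 'I_N) (x : Qp)
  : Qp := foldl (fun y j => Phi j y) x w.

Definition self_similar_string (N K : nat) (Phi : 'I_N -> Qp -> Qp)
    (G : 'I_K -> set Qp) : set Qp :=
  \bigcup_(w in [set: seq 'I_N]) \bigcup_(k in [set: 'I_K])
    (word_map Phi w @` G k).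

End PadicNumbers.

Section ComplexFunctions.
Variable R : realType.
(* The regular module R[i]^o carries the topology of the complex numbers. *)
Local Notation C := (R[i]^o).

(* x ^ s = exp (s ln x) for x > 0. *)
Definition cpow (x : R) (s : C) : C :=
  (x `^ complex.Re s * cos (complex.Im s * ln x)
   +i* (x `^ complex.Re s * sin (complex.Im s * ln x)))%C.

Definition has_power_series_sum (c : nat -> C) (u w : C) : Prop :=
  series (fun k => c k * u ^+ k) @ \oo --> w.

Definition analytic_at (f : C -> C) (a : C) : Prop :=
  exists c, \forall s \near a, has_power_series_sum c (s - a) (f s).

Definition pole_at (f : C -> C) (a : C) : Prop :=
  exists (n : nat) (c : nat -> C), [/\ (0 < n)%N, c 0%N != 0 &
    \forall s \near a^', has_power_series_sum c (s - a) ((s - a) ^+ n * f s)].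

(* Each point is either a point of analyticity or an isolated singularity with a
   finite, nonzero principal part; the value of f at a pole is irrelevant. *)
Definition meromorphic (f : C -> C) : Prop :=
  forall a, analytic_at f a \/ pole_at f a.

(* f is a meromorphic continuation to the plane of the Dirichlet series
   sum_B mu(B)^s, B ranging over the convex components of L; the series is an
   unordered sum, i.e. the limit of its finite partial sums along inclusion. *)
Definition is_geometric_zeta (p : nat) (p_pr : prime p)
    (mu : {measure set (padic_borel R p_pr) -> \bar R}) (L : set (padic p_pr))
    (f : C -> C) : Prop :=
  meromorphic f /\
  exists sigma : R, forall s : C, sigma < complex.Re s ->
    (fun J : {fset set (padic p_pr)} =>
       \sum_(B <- J | B \in convex_components R L) cpow (fine (mu B)) s)
      @ totally --> f s.

End ComplexFunctions.

(* Main.v *)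
(* The convex components of L are the balls Phi_w(G_k), pairwise distinct, of
   measure p^-(n_w1 + ... + n_wa + m_k): a larger ball inside L would, pulled back
   by Phi_w, contain Z_p or some Phi_j(Z_p), hence a fixed point of some Phi_j;
   but the images of such points under words lie in images of Z_p of every level
   and so avoid L.  For Re s >= 1 the sum over words is a geometric series in
   sum_j z^(n'_j), whose norm is at most sum_j r_j < 1, which gives the formula.
   The right-hand side is a quotient of entire functions, hence extends to a
   meromorphic function; and two meromorphic functions that agree on an open set
   agree near every point, since the points near which they agree, and those near
   which they differ, form two open sets covering the connected plane. *)
Require Import Defs.
From HB Require Import structures.
From mathcomp Require Import all_boot all_order all_algebra.
From mathcomp Require Import fraction finmap.
From mathcomp Require Import all_classical all_reals all_analysis.
From mathcomp Require Import summability complex ring.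

Set Implicit Arguments.
Unset Strict Implicit.
Unset Printing Implicit Defensive.

Import numFieldNormedType.Exports.
Import Order.TTheory GRing.Theory Num.Theory.

Local Open Scope classical_set_scope.
Local Open Scope ring_scope.

(** * Cauchy products of complex series *)

Section ComplexSequences.
Variable R : realType.
Local Notation C := (R[i]^o).

(** Analyticity and poles are defined by local power series, so the complex analysis is a calculus
    of expansions on punctured neighbourhoods. Convergence at one nonzero point already bounds the
    coefficients by M rho^k; after shrinking to |u| rho <= 1/8, products and inverses of series
    follow from explicit geometric estimates. Values at the centre are recovered last, as limits:
    [analytic_at] prescribes them, while a field quotient takes a default value where its
    denominator vanishes. On the p-adic side, two balls that meet are nested, which turns each
    maximality argument into a comparison of two balls. *)

Lemma cvg_complexX (x : C) : `|x| < 1 -> (fun n => x ^+ n : C) @ \oo --> (0 : C).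
Proof.
move=> x1; apply/cvgr0Pnorm_lt => e e0.
(* A positive element of C is real, so the claim reduces to powers of a real number. *)
have eE : e = (complex.Re e)%:C%C by rewrite RRe_real // gtr0_real.
have e'0 : 0 < complex.Re e by rewrite -ltcR -eE.
have xE : `|x| = (complex.Re `|x|)%:C%C by rewrite RRe_real // normr_real.
have rx0 : 0 <= complex.Re `|x| by rewrite -lecR -xE normr_ge0.
have rx1 : `|complex.Re `|x| | < 1 by rewrite ger0_norm // -ltcR -xE.
have /cvgr0Pnorm_lt /(_ _ e'0) h := cvg_expr rx1.
near=> n; rewrite normrX xE eE -rmorphXn ltcR.
have : `|complex.Re `|x| ^+ n| < complex.Re e by near: n.
by rewrite ger0_norm // exprn_ge0.
Unshelve. all: by end_near. Qed.

Lemma cvg_halfX : (fun n => 2^-1 ^+ n : C) @ \oo --> (0 : C).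
Proof. by apply: cvg_complexX; rewrite ger0_norm ?invr_ge0 // invf_lt1 // ltr1n. Qed.

Lemma cvg0_le_halfX (f : nat -> C) (M : C) :
  (forall n, `|f n| <= M * 2^-1 ^+ n) -> f @ \oo --> (0 : C).
Proof.
move=> fM; apply/cvgr0Pnorm_lt => e e0.
have M0 : 0 <= M by apply: le_trans (normr_ge0 _) _; have := fM 0%N; rewrite mulr1; exact.
have e1 : 0 < e / (M + 1) by rewrite divr_gt0 // ltr_wpDl.
have /cvgr0Pnorm_lt /(_ _ e1) h := cvg_halfX.
near=> n; apply: le_lt_trans (fM n) _.
have : `|2^-1 ^+ n : C| < e / (M + 1) by near: n.
rewrite normrX ger0_norm ?invr_ge0 // ltr_pdivlMr ?ltr_wpDl // => /(le_lt_trans _); apply.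
by rewrite mulrC ler_wpM2l ?exprn_ge0 ?invr_ge0 // lerDl.
Unshelve. all: by end_near. Qed.

Definition cauchy_prod (a b : nat -> C) (k : nat) : C :=
  \sum_(i < k.+1) a i * b (k - i)%N.

(* The rate 8^-1 absorbs both the k + 1 terms of the k-th coefficient and the n
   coefficients of degree n, ..., 2n - 1 that the partial products have in excess. *)
Lemma cauchy_prod_error (a b : nat -> C) (M : C) :
  (forall k, `|a k| <= M * 8^-1 ^+ k) -> (forall k, `|b k| <= M * 8^-1 ^+ k) ->
  forall n, `|series a n * series b n - series (cauchy_prod a b) n|
    <= M ^+ 2 * 2^-1 ^+ n.
Proof.
move=> aM bM n.
have M0 : 0 <= M by apply: le_trans (normr_ge0 _) _; have := aM 0%N; rewrite mulr1; exact.
(* The partial sums are values at 1 of truncated polynomials; the coefficients of A * B below degree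
   n are exactly those of the Cauchy product. *)
pose A : {poly R[i]} := \poly_(i < n) a i.
pose B : {poly R[i]} := \poly_(i < n) b i.
have hA : series a n = A.[1].
  rewrite /series /= big_mkord horner_poly.
  by apply: eq_bigr => i _; rewrite expr1n mulr1.
have hB : series b n = B.[1].
  rewrite /series /= big_mkord horner_poly.
  by apply: eq_bigr => i _; rewrite expr1n mulr1.
have sAB : (size (A * B)%R <= n + n)%N.
  apply: leq_trans (size_polyMleq _ _) _; apply: leq_trans (leq_pred _) _.
  by rewrite leq_add // size_poly.
rewrite hA hB -hornerM (horner_coef_wide _ sAB) /series /= big_mkord.
rewrite big_split_ord /=.
have -> : \sum_(i < n) (A * B)`_i * 1 ^+ i = \sum_(i < n) cauchy_prod a b i.
  apply: eq_bigr.
  move=> i _; rewrite expr1n mulr1 coefM /cauchy_prod; apply: eq_bigr => j _.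
  rewrite !coef_poly (leq_ltn_trans (leq_ord j) (ltn_ord i)).
  by rewrite (leq_ltn_trans (leq_subr _ _) (ltn_ord i)).
rewrite addrAC subrr add0r.
apply: le_trans (ler_norm_sum _ _ _) _.
have step (i : 'I_n) : `|(A * B)`_(n + i) * 1 ^+ (n + i)| <= M ^+ 2 * 4^-1 ^+ n.
  rewrite expr1n mulr1 coefM.
  apply: le_trans (ler_norm_sum _ _ _) _.
  apply: (@le_trans _ _ (\sum_(j < (n + i).+1) M ^+ 2 * 8^-1 ^+ (n + i))).
    apply: ler_sum => j _; rewrite normrM.
    have hP (c : nat -> C) k : (forall k, `|c k| <= M * 8^-1 ^+ k) ->
        `|(\poly_(i < n) c i)`_k| <= M * 8^-1 ^+ k.
      move=> cM; rewrite coef_poly; case: ifP => _; first exact: cM.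
      by rewrite normr0 mulr_ge0 // exprn_ge0 // invr_ge0.
    apply: le_trans (ler_pM _ _ (hP _ _ aM) (hP _ _ bM)) _ => //.
    rewrite mulrACA -exprD subnKC ?expr2 //; exact: (leq_ord j).
  rewrite sumr_const card_ord -mulrnAr ler_wpM2l ?exprn_ge0 //.
  apply: (@le_trans _ _ (4^-1 ^+ (n + i))); last first.
    by rewrite exprD ler_piMr ?exprn_ge0 ?exprn_ile1 ?invr_ge0 ?invf_le1 ?ler1n.
  have -> : (8^-1 : R[i]) = 2^-1 * 4^-1 by rewrite -invfM -natrM.
  rewrite exprMn -mulrnAl ler_piMl ?exprn_ge0 ?invr_ge0 //.
  rewrite -mulr_natr exprVn mulrC ler_pdivrMr ?exprn_gt0 // mul1r -natrX ler_nat.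
  by apply: ltn_expl.
apply: le_trans (ler_sum _ (fun i _ => step i)) _.
rewrite sumr_const card_ord -mulrnAr ler_wpM2l ?exprn_ge0 //.
have -> : (4^-1 : R[i]) = 2^-1 * 2^-1 by rewrite -invfM -natrM.
rewrite exprMn -mulrnAl ler_piMl ?exprn_ge0 ?invr_ge0 //.
rewrite -mulr_natr exprVn mulrC ler_pdivrMr ?exprn_gt0 // mul1r -natrX ler_nat.
by apply/ltnW/ltn_expl.
Qed.

Lemma cvg_cauchy_prod (a b : nat -> C) (M : C) (x y : C) :
  (forall k, `|a k| <= M * 8^-1 ^+ k) -> (forall k, `|b k| <= M * 8^-1 ^+ k) ->
  series a @ \oo --> x -> series b @ \oo --> y ->
  series (cauchy_prod a b) @ \oo --> (x * y : C).
Proof.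
move=> aM bM ax bY.
have h := cvg0_le_halfX (cauchy_prod_error aM bM).
rewrite -[x * y]subr0; apply: cvg_trans (cvgB (cvgM ax bY) h).
apply: near_eq_cvg; near=> n => /=.
by rewrite !fctE opprB addrC subrK.
Unshelve. all: by end_near. Qed.

(** Convergence of [series b] is part of the conclusion: the products of partial sums tend to 1, and
    one divides by the partial sums of [a], which are eventually nonzero. *)
Lemma cvg_cauchy_inv (a b : nat -> C) (M : C) (x : C) :
  (forall k, `|a k| <= M * 8^-1 ^+ k) -> (forall k, `|b k| <= M * 8^-1 ^+ k) ->
  (forall k, cauchy_prod a b k = (k == 0%N)%:R) -> x != 0 ->
  series a @ \oo --> x -> series b @ \oo --> (x^-1 : C).
Proof.
move=> aM bM ab x0 ax.
have h := cvg0_le_halfX (cauchy_prod_error aM bM).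
have ab1 : (fun n => series a n * series b n) @ \oo --> (1 : C).
  rewrite -[X in _ --> X]add0r.
  apply: cvg_trans (cvgD h (cvg_cst (1 : C))).
  apply: near_eq_cvg; near=> n => /=.
  rewrite !fctE [series (cauchy_prod a b) n](_ : _ = 1) ?subrK //.
  rewrite /series /= -(@prednK n); last by near: n; exists 1%N.
  rewrite big_nat_recl // ab eqxx big1 ?addr0 // => i _; by rewrite ab.
rewrite -[x^-1]mulr1; apply: cvg_trans (cvgM (cvgV x0 ax) ab1).
have a0 := cvgr_neq0 _ ax x0.
apply: near_eq_cvg; near=> n => /=.
rewrite ?fctE mulrA mulVf ?mul1r //; near: n; exact: a0.
Unshelve. all: by end_near. Qed.

End ComplexSequences.

(** * Power series expansions *)

Section PowerSeries.
Variable R : realType.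
Local Notation C := (R[i]^o).
Implicit Types (f g : C -> C) (c e : nat -> C) (a : C).

Definition geom_bounded c (M rho : C) : Prop :=
  [/\ 0 <= M, 0 < rho & forall k, `|c k| <= M * rho ^+ k].

Lemma geom_boundedW c M rho M' rho' : M <= M' -> rho <= rho' ->
  geom_bounded c M rho -> geom_bounded c M' rho'.
Proof.
move=> MM rr [M0 r0 cM]; split; [exact: le_trans M0 MM|exact: lt_le_trans r0 rr|].
move=> k; apply: le_trans (cM k) _; rewrite ler_pM ?exprn_ge0 ?(ltW r0) //.
by rewrite lerXn2r // nnegrE ltW // (lt_le_trans r0).
Qed.

Lemma geom_bounded_scaled c M rho u : geom_bounded c M rho -> `|u| * rho <= 8^-1 ->
  forall k, `|c k * u ^+ k| <= M * 8^-1 ^+ k.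
Proof.
move=> [M0 r0 cM] ur k; rewrite normrM normrX.
apply: (@le_trans _ _ (M * rho ^+ k * `|u| ^+ k)).
  by rewrite ler_wpM2r ?exprn_ge0.
rewrite -mulrA -exprMn ler_wpM2l // lerXn2r // ?nnegrE ?invr_ge0 //.
  by rewrite mulr_ge0 // ltW.
by rewrite mulrC.
Qed.

(** The terms of a convergent series are bounded, so |c k| <= M |u|^-k; this one point of
    convergence yields every later estimate. *)
Lemma power_series_bounded c u w : u != 0 -> has_power_series_sum c u w ->
  exists M rho, geom_bounded c M rho.
Proof.
move=> u0 /cvgP/cvg_series_cvg_0/cvgP/cvg_seq_bounded.
move=> /(@ex_bound _ _ _ _ _ (@globally_properfilter nat setT 0%N I))[M cM].
have M0 : 0 <= M by apply: le_trans (normr_ge0 _) (cM 0%N I).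
exists M, `|u|^-1; split=> //; first by rewrite invr_gt0 normr_gt0.
move=> k; have := cM k I; rewrite /= normrM normrX exprVn.
by rewrite ler_pdivlMr // exprn_gt0 // normr_gt0.
Qed.

Lemma near_scaled a (rho : C) : 0 < rho -> \forall s \near a, `|s - a| * rho <= 8^-1.
Proof.
move=> r0; apply/nbhs_normP; exists (8^-1 / rho).
  by rewrite /= divr_gt0.
by move=> s /=; rewrite distrC ltr_pdivlMr // => /ltW.
Qed.

Lemma near_dist a (r : C) : 0 < r -> \forall s \near a, `|s - a| < r.
Proof.
by move=> r0; apply/nbhs_normP; exists r => // s /=; rewrite distrC.
Qed.

(* A power series expansion valid on a punctured neighbourhood; the germ
   calculus below ignores the value at the centre. *)
Definition expands f a c : Prop :=
  \forall s \near a^', has_power_series_sum c (s - a) (f s).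

Lemma expands_bounded f a c : expands f a c -> exists M rho, geom_bounded c M rho.
Proof.
move=> fc; have [s [sa fs]] := filter_ex (filterI (nbhs_dnbhs_neq a) fc).
by apply: power_series_bounded fs; rewrite subr_eq0.
Qed.


Lemma power_series_sum0 c : has_power_series_sum c 0 (c 0%N).
Proof.
apply/cvgrPdist_lt => e e0; near=> n.
rewrite /series /= -(@prednK n); last by near: n; exists 1%N.
rewrite big_nat_recl // expr0 mulr1 big1 ?addr0 ?subrr ?normr0 // => i _.
by rewrite expr0n mulr0.
Unshelve. all: by end_near. Qed.

Lemma power_series_sum_unique c u v w :
  has_power_series_sum c u v -> has_power_series_sum c u w -> v = w.
Proof. by move=> cv cw; apply: cvg_unique cv cw. Qed.

Lemma power_series_sumD c e u v w :
  has_power_series_sum c u v -> has_power_series_sum e u w ->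
  has_power_series_sum (fun k => c k + e k) u (v + w).
Proof.
move=> cv ew; apply: cvg_trans (cvgD cv ew); apply: near_eq_cvg.
near=> n => /=; rewrite ?fctE /series /= -big_split /=.
by apply: eq_bigr => i _; rewrite mulrDl.
Unshelve. all: by end_near. Qed.

Lemma power_series_sumZ c u v x :
  has_power_series_sum c u v -> has_power_series_sum (fun k => x * c k) u (x * v).
Proof.
move=> cv; apply: cvg_trans (cvgM (cvg_cst (x : C)) cv); apply: near_eq_cvg.
near=> n => /=; rewrite ?fctE /series /= mulr_sumr.
by apply: eq_bigr => i _; rewrite mulrA.
Unshelve. all: by end_near. Qed.

Lemma power_series_sum_shift c u w : u != 0 -> has_power_series_sum c u w ->
  has_power_series_sum (fun k => c k.+1) u ((w - c 0%N) / u).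
Proof.
move=> u0; rewrite {1}/has_power_series_sum -cvg_shiftS => cw.
apply: cvg_trans (cvgM (cvgB cw (cvg_cst (c 0%N : C))) (cvg_cst (u^-1 : C))).
apply: near_eq_cvg; near=> n => /=; rewrite ?fctE /series /=.
rewrite big_nat_recl // expr0 mulr1 addrAC subrr add0r mulr_suml.
by apply: eq_bigr => i _; rewrite exprSr mulrA mulfK.
Unshelve. all: by end_near. Qed.

Lemma power_series_sumM c e u v w M rho :
  geom_bounded c M rho -> geom_bounded e M rho -> `|u| * rho <= 8^-1 ->
  has_power_series_sum c u v -> has_power_series_sum e u w ->
  has_power_series_sum (cauchy_prod c e) u (v * w).
Proof.
move=> cb eb ur cv ew.
have := cvg_cauchy_prod (geom_bounded_scaled cb ur) (geom_bounded_scaled eb ur) cv ew.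
rewrite /has_power_series_sum; set x := cauchy_prod _ _.
have -> // : x = (fun k => cauchy_prod c e k * u ^+ k).
apply/funext => k; rewrite {1}/x /cauchy_prod mulr_suml; apply: eq_bigr => i _.
by rewrite mulrACA -exprD subnKC // (leq_ord i).
Qed.

(** [2 * M] bounds all partial sums, through the sum of the powers of 1/2; the extra 1 is the
    distance from a late partial sum to the limit. *)
Lemma power_series_sum_bounded c u w M rho :
  geom_bounded c M rho -> `|u| * rho <= 8^-1 ->
  has_power_series_sum c u w -> `|w| <= 2 * M + 1.
Proof.
move=> cb ur cw; have [M0 _ _] := cb.
have cM := geom_bounded_scaled cb ur.
have /cvgrPdist_lt /(_ 1 ltr01) h := cw.
have [n _ /(_ n (leqnn n)) hn] := h.
rewrite -[w](subrK (series (fun k => c k * u ^+ k) n)) addrC.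
apply: le_trans (ler_normD _ _) _; apply: lerD; last exact: ltW.
rewrite /series /= big_mkord; apply: le_trans (ler_norm_sum _ _ _) _.
apply: (@le_trans _ _ (\sum_(i < n) M * 2^-1 ^+ i)).
  apply: ler_sum => i _; apply: le_trans (cM i) _.
  rewrite ler_wpM2l // lerXn2r ?nnegrE ?invr_ge0 // lef_pV2 ?posrE //.
  by rewrite ler_nat.
rewrite -mulr_sumr mulrC ler_wpM2r //.
have := subrX1 (2^-1 : C) n.
have -> : 2^-1 - 1 = - 2^-1 :> C by rewrite {2}(splitr 1) div1r opprD addrA subrr add0r.
rewrite mulNr -[LHS]opprB => /oppr_inj hS.
have -> : \sum_(i < n) 2^-1 ^+ i = 2 * (1 - 2^-1 ^+ n) :> C.
  by rewrite hS mulrA mulfV ?mul1r.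
by rewrite ler_piMr // gerBl exprn_ge0 // invr_ge0.
Qed.

Lemma expands_eq f g a c : (\forall s \near a^', f s = g s) ->
  expands f a c -> expands g a c.
Proof. by apply: filterS2 => s ->. Qed.

Lemma expandsD f g a c e : expands f a c -> expands g a e ->
  expands (fun s => f s + g s) a (fun k => c k + e k).
Proof. by apply: filterS2 => s; exact: power_series_sumD. Qed.

Lemma expandsZ f a c x : expands f a c -> expands (fun s => x * f s) a (fun k => x * c k).
Proof. by apply: filterS => s; exact: power_series_sumZ. Qed.

Lemma expandsN f a c : expands f a c -> expands (fun s => - f s) a (fun k => - c k).
Proof.
move=> /(expandsZ (-1)); rewrite (_ : (fun k => -1 * c k) = (fun k => - c k)).
  by apply: expands_eq; apply: nearW => s; rewrite mulN1r.
by apply/funext => k; rewrite mulN1r.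
Qed.

Lemma near_dnbhs_scaled a (rho : C) : 0 < rho ->
  \forall s \near a^', `|s - a| * rho <= 8^-1.
Proof. by move=> /(near_scaled a); apply: nbhs_dnbhs. Qed.

Lemma expandsM f g a c e : expands f a c -> expands g a e ->
  expands (fun s => f s * g s) a (cauchy_prod c e).
Proof.
move=> fc ge.
have [M1 [r1 b1]] := expands_bounded fc; have [M2 [r2 b2]] := expands_bounded ge.
have [M10 r10 _] := b1; have [M20 r20 _] := b2.
have {}b1 : geom_bounded c (M1 + M2) (r1 + r2).
  by apply: geom_boundedW b1; rewrite ?lerDl // ltW.
have {}b2 : geom_bounded e (M1 + M2) (r1 + r2).
  by apply: geom_boundedW b2; rewrite ?lerDr // ltW.
have [_ r0 _] := b1.
apply: filterS3 (near_dnbhs_scaled a r0) fc ge => s sr fs gs.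
exact: power_series_sumM b1 b2 sr fs gs.
Qed.

Lemma expands_cst x a : expands (fun _ => x) a (fun k => x * (k == 0%N)%:R).
Proof.
apply: nearW => s; apply/cvgrPdist_lt => e e0; near=> n.
rewrite /series /= -(@prednK n); last by near: n; exists 1%N.
rewrite big_nat_recl // expr0 !mulr1 big1 ?addr0 ?subrr ?normr0 // => i _.
by rewrite mulr0 mul0r.
Unshelve. all: by end_near. Qed.

Lemma expandsX a n : expands (fun s => (s - a) ^+ n) a (fun k => (k == n)%:R).
Proof.
apply: nearW => s; apply/cvgrPdist_lt => e e0; near=> N.
have nN : (n < N)%N by near: N; exists n.+1.
rewrite /series /= big_mkord (bigD1 (Ordinal nN)) //= eqxx mul1r.
rewrite big1 ?addr0 ?subrr ?normr0 // => i /negbTE.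
by rewrite -val_eqE /= => ->; rewrite mul0r.
Unshelve. all: by end_near. Qed.

Lemma expands_shift f a c : expands f a c ->
  expands (fun s => (f s - c 0%N) / (s - a)) a (fun k => c k.+1).
Proof.
move=> fc; near=> s; apply: power_series_sum_shift; last by near: s.
by rewrite subr_eq0; near: s; exact: nbhs_dnbhs_neq.
Unshelve. all: by end_near. Qed.

(** The shifted expansion bounds (f s - c 0) / (s - a) near a, so f s - c 0 is O(s - a). *)
Lemma expands_cvg f a c : expands f a c -> f @ a^' --> (c 0%N : C).
Proof.
move=> fc; have gc := expands_shift fc; have [M [r b]] := expands_bounded gc.
have [M0 r0 _] := b.
apply/cvgrPdist_lt => e e0.
have M1 : 0 < 2 * M + 1 by rewrite ltr_wpDl // mulr_ge0.
have d0 : 0 < e / (2 * M + 1) by rewrite divr_gt0.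
near=> s; have sa : s != a by near: s; exact: nbhs_dnbhs_neq.
have : `|(f s - c 0%N) / (s - a)| <= 2 * M + 1.
  have sr : `|s - a| * r <= 8^-1 by near: s; exact: near_dnbhs_scaled.
  by apply: power_series_sum_bounded b sr _; near: s.
rewrite normrM normfV ler_pdivrMr ?normr_gt0 ?subr_eq0 // distrC => /le_lt_trans; apply.
have : `|s - a| < e / (2 * M + 1).
  by near: s; apply: nbhs_dnbhs; exact: (near_dist a d0).
by rewrite ltr_pdivlMr // mulrC.
Unshelve. all: by end_near. Qed.

Lemma expands_factor f a c n : expands f a c -> (forall k, (k < n)%N -> c k = 0) ->
  expands (fun s => f s / (s - a) ^+ n) a (fun k => c (n + k)%N).
Proof.
move=> fc; elim: n => [|n IHn] c0.
  by apply: expands_eq fc; apply: nearW => s; rewrite expr0 divr1.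
have /expands_shift := IHn (fun k kn => c0 k (ltnW kn)).
rewrite addn0 (c0 n (ltnSn n)).
have -> : (fun k => c (n.+1 + k)%N) = (fun k => c (n + k.+1)%N).
  by apply/funext => k; rewrite addnS addSn.
by apply: expands_eq; apply: nearW => s; rewrite subr0 exprSr invfM mulrA mulrAC.
Qed.

Lemma first_nonzero_coef c :
  (forall k, c k = 0) \/ exists2 n, c n != 0 & forall k, (k < n)%N -> c k = 0.
Proof.
have [c0|/existsNP[n /eqP cn]] := pselect (forall k, c k = 0); [by left|right].
have ex : exists n, c n != 0 by exists n.
exists (ex_minn ex); first by case: ex_minnP.
by case: ex_minnP => m _ mP k; apply: contraTeq => /mP; rewrite -leqNgt.
Qed.

Lemma expands0 f a c : expands f a c -> (forall k, c k = 0) -> \forall s \near a^', f s = 0.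
Proof.
move=> fc c0; near=> s; apply: (@power_series_sum_unique c (s - a)).
  by near: s; exact: fc.
apply/cvgrPdist_lt => e e0; near=> n.
by rewrite /series /= big1 ?subrr ?normr0 // => i _; rewrite c0 mul0r.
Unshelve. all: by end_near. Qed.

(** Dividing by (s - a)^n, with n the index of the first nonzero coefficient, leaves a function with
    the nonzero limit c n. *)
Lemma expands_isolated_zeros f a c : expands f a c ->
  (\forall s \near a^', f s = 0) \/ (\forall s \near a^', f s != 0).
Proof.
move=> fc; have [/(expands0 fc)|[n cn /(expands_factor fc)/expands_cvg]] := first_nonzero_coef c.
  by left.
rewrite addn0 => gc; right.
have gs : \forall s \near a^', f s / (s - a) ^+ n != 0 by exact: cvgr_neq0 _ gc cn.
by apply: filterS gs => s; apply: contraNneq => ->; rewrite mul0r.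
Qed.

(** Each coefficient of the inverse series depends on all earlier ones; carrying the whole list
    makes the recursion structural. *)
Fixpoint inv_coefs c n : seq C :=
  if n is m.+1 then
    rcons (inv_coefs c m)
      (- (c 0%N)^-1 * \sum_(i < m.+1) c i.+1 * (inv_coefs c m)`_(m - i))
  else [:: (c 0%N)^-1].

Lemma size_inv_coefs c n : size (inv_coefs c n) = n.+1.
Proof. by elim: n => //= n IHn; rewrite size_rcons IHn. Qed.

Definition inv_coef c n : C := (inv_coefs c n)`_n.

Lemma nth_inv_coefs c n k : (k <= n)%N -> (inv_coefs c n)`_k = inv_coef c k.
Proof.
elim: n => [|n IHn]; first by rewrite leqn0 => /eqP ->.
rewrite leq_eqVlt => /predU1P[->//|kn] /=.
by rewrite nth_rcons size_inv_coefs kn IHn.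
Qed.

Lemma inv_coefS c n : inv_coef c n.+1 =
  - (c 0%N)^-1 * \sum_(i < n.+1) c i.+1 * inv_coef c (n - i).
Proof.
rewrite {1}/inv_coef /= nth_rcons size_inv_coefs ltnn eqxx; congr (_ * _).
by apply: eq_bigr => i _; rewrite nth_inv_coefs // leq_subr.
Qed.

Lemma cauchy_prod_inv c k : c 0%N != 0 -> cauchy_prod c (inv_coef c) k = (k == 0%N)%:R.
Proof.
move=> c0; rewrite /cauchy_prod; case: k => [|k].
  by rewrite big_ord_recl big_ord0 addr0 /= mulfV.
rewrite big_ord_recl /= subn0 inv_coefS mulrA mulrN mulfV // mulN1r.
by apply/eqP; rewrite addrC subr_eq0; apply/eqP/eq_bigr => i _.
Qed.

(** The rate t is chosen so that t - rho = M rho / |c 0|. The recurrence then bounds the next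
    coefficient by |c 0|^-1 times (t - rho) \sum t^(n-i) rho^i = t^(n+1) - rho^(n+1). *)
Lemma inv_coef_bounded c M rho : c 0%N != 0 -> geom_bounded c M rho ->
  geom_bounded (inv_coef c) `|c 0%N|^-1 (rho * (1 + M * `|c 0%N|^-1)).
Proof.
move=> c0 [M0 r0 cM]; set B := `|c 0%N|^-1; set t := rho * _.
have B0 : 0 <= B by rewrite invr_ge0.
have t0 : 0 < t by rewrite mulr_gt0 // ltr_wpDr // mulr_ge0.
split => // n; have [m] := ubnP n; elim: m n => // m IHm [|n] nm.
  by rewrite /inv_coef /= normfV mulr1.
rewrite inv_coefS normrM normrN normfV ler_wpM2l //.
apply: le_trans (ler_norm_sum _ _ _) _.
apply: (@le_trans _ _ (\sum_(i < n.+1) (t - rho) * (t ^+ (n.+1.-1 - i) * rho ^+ i))).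
  apply: ler_sum => i _; rewrite normrM.
  apply: le_trans (ler_pM _ _ (cM _) (IHm _ _)) _ => //.
    exact: leq_ltn_trans (leq_subr _ _) (ltnSE nm).
  have -> : t - rho = M * rho * B by rewrite /t mulrDr mulr1 addrAC subrr add0r mulrCA mulrA.
  by rewrite exprS /= -!mulrA (mulrC (rho ^+ i)) -!mulrA.
by rewrite -mulr_sumr -subrXX gerBl exprn_ge0 // ltW.
Qed.

Lemma expandsV f a c : c 0%N != 0 -> expands f a c ->
  expands (fun s => (f s)^-1) a (inv_coef c).
Proof.
move=> c0 fc; have [M1 [r1 b1]] := expands_bounded fc.
have b2 := inv_coef_bounded c0 b1.
have [M10 r10 _] := b1; have [M20 r20 _] := b2.
set M2 := `|_|^-1 in b2 M20; set r2 := _ * _ in b2 r20.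
have {}b1 : geom_bounded c (M1 + M2) (r1 + r2).
  by apply: geom_boundedW b1; rewrite ?lerDl // ltW.
have {}b2 : geom_bounded (inv_coef c) (M1 + M2) (r1 + r2).
  by apply: geom_boundedW b2; rewrite ?lerDr // ltW.
have [_ r0 _] := b1.
have fs : \forall s \near a^', f s != 0 by exact: cvgr_neq0 _ (expands_cvg fc) c0.
apply: filterS3 (near_dnbhs_scaled a r0) fc fs => s sr fcs fs0.
apply: (cvg_cauchy_inv (geom_bounded_scaled b1 sr) (geom_bounded_scaled b2 sr)).
- move=> k; transitivity (cauchy_prod c (inv_coef c) k * (s - a) ^+ k).
    rewrite /cauchy_prod mulr_suml; apply: eq_bigr => i _.
    by rewrite mulrACA -exprD subnKC // (leq_ord i).
  by rewrite cauchy_prod_inv //; case: k => [|k]; rewrite ?mul1r ?expr0 ?mul0r.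
- exact: fs0.
- exact: fcs.
Qed.

End PowerSeries.

(** * Meromorphic functions *)

Section Meromorphic.
Variable R : realType.
Local Notation C := (R[i]^o).
Implicit Types (f g P Q : C -> C) (a b : C).

Lemma analytic_expands f a : analytic_at f a -> exists2 c, expands f a c & f a = c 0%N.
Proof.
move=> [c fc]; exists c; first exact: nbhs_dnbhs fc.
have := nbhs_singleton fc; rewrite subrr => /power_series_sum_unique; apply.
exact: power_series_sum0.
Qed.

Lemma expands_analytic f a c : expands f a c -> f a = c 0%N -> analytic_at f a.
Proof.
move=> fc fa; exists c.
have {}fc : \forall s \near a, s != a -> has_power_series_sum c (s - a) (f s) by exact: fc.
apply: filterS fc => s h.
have [->|sa] := eqVneq s a; first by rewrite subrr fa; exact: power_series_sum0.
exact: h.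
Qed.

Lemma analytic_cst x a : analytic_at (fun _ : C => x) a.
Proof. by apply: expands_analytic (expands_cst x a) _; rewrite mulr1. Qed.

Lemma analyticD f g a : analytic_at f a -> analytic_at g a ->
  analytic_at (fun s => f s + g s) a.
Proof.
move=> /analytic_expands[c fc fa] /analytic_expands[e ge ga].
by apply: expands_analytic (expandsD fc ge) _; rewrite fa ga.
Qed.

Lemma analyticN f a : analytic_at f a -> analytic_at (fun s => - f s) a.
Proof.
move=> /analytic_expands[c fc fa].
by apply: expands_analytic (expandsN fc) _; rewrite fa.
Qed.

Lemma analyticM f g a : analytic_at f a -> analytic_at g a ->
  analytic_at (fun s => f s * g s) a.
Proof.
move=> /analytic_expands[c fc fa] /analytic_expands[e ge ga].
apply: expands_analytic (expandsM fc ge) _.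
by rewrite /cauchy_prod big_ord_recl big_ord0 addr0 fa ga.
Qed.

Lemma analyticV f a : f a != 0 -> analytic_at f a -> analytic_at (fun s => (f s)^-1) a.
Proof.
move=> fa0 /analytic_expands[c fc fa]; rewrite fa in fa0.
by apply: expands_analytic (expandsV fa0 fc) _; rewrite fa.
Qed.

Lemma analyticX f a n : analytic_at f a -> analytic_at (fun s => f s ^+ n) a.
Proof.
move=> fa; elim: n => [|n IHn]; first exact: analytic_cst.
by under [X in analytic_at X _]eq_fun do rewrite exprS; exact: analyticM.
Qed.

Lemma analytic_sum (I : Type) (r : seq I) (F : I -> C -> C) a :
  (forall i, analytic_at (F i) a) -> analytic_at (fun s => \sum_(i <- r) F i s) a.
Proof.
move=> Fa; elim: r => [|i r IHr].
  by under [X in analytic_at X _]eq_fun do rewrite big_nil; exact: analytic_cst.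
have -> : (fun s => \sum_(j <- i :: r) F j s) = (fun s => F i s + \sum_(j <- r) F j s).
  by apply/funext => s; rewrite big_cons.
exact: (analyticD (Fa i) IHr).
Qed.

(** A form that ignores the value at [a] and does not ask for the least exponent, so that it covers
    regular points, removable singularities and poles alike. *)
Definition meromorphic_at f a : Prop :=
  exists n c, expands (fun s => (s - a) ^+ n * f s) a c.

Lemma meromorphicP f : meromorphic f -> forall a, meromorphic_at f a.
Proof.
move=> mf a; case: (mf a) => [/analytic_expands[c fc _]|[n [c [_ _ fc]]]].
  exists 0%N, c; apply: expands_eq fc; apply: nearW => s; by rewrite mul1r.
by exists n, c.
Qed.

(** Multiplying by (s - a)^(m + n) clears both poles without changing where f and g agree off a;
    isolation of zeros applies to the difference. *)
Lemma meromorphic_at_dichotomy f g a : meromorphic_at f a -> meromorphic_at g a ->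
  (\forall s \near a^', f s = g s) \/ (\forall s \near a^', f s != g s).
Proof.
move=> [n [c fc]] [m [e ge]].
have h := expandsD (expandsM (expandsX a m) fc) (expandsN (expandsM (expandsX a n) ge)).
have hE (s : C) : s != a -> ((s - a) ^+ m * ((s - a) ^+ n * f s) -
    (s - a) ^+ n * ((s - a) ^+ m * g s) == 0) = (f s == g s).
  move=> sa; rewrite [X in _ - X]mulrCA -!mulrBr !mulf_eq0 !expf_eq0 subr_eq0.
  by rewrite (negbTE sa) !andbF /= subr_eq0.
have [h0|h0] := expands_isolated_zeros h; [left|right];
  apply: filterS2 h0 (nbhs_dnbhs_neq a) => s h0 sa.
- by apply/eqP; rewrite -hE //; exact/eqP.
- by rewrite -hE.
Qed.

(** A punctured neighbourhood of a contains a full neighbourhood of each nearby b != a. This makes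
    the sets of centres in the identity theorem open. *)
Lemma near_dnbhs_open a (A : C -> Prop) : (\forall s \near a^', A s) ->
  \forall b \near a, \forall s \near b^', A s.
Proof.
move=> hA; have {}hA : nbhs a [set s | s != a -> A s] by exact: hA.
apply: filterS (nbhs_interior hA) => b hb.
have [->|ba] := eqVneq b a; first exact: hA.
have ba0 : 0 < `|b - a| by rewrite normr_gt0 subr_eq0.
apply: nbhs_dnbhs; apply: filterS2 hb (near_dist b ba0) => s h sb; apply: h.
by apply: contraTneq sb => ->; rewrite distrC ltxx.
Qed.

Lemma norm_real_complex (x : R) : `|x%:C%C| = `|x|%:C%C :> C.
Proof. by rewrite normc_def /= expr0n addr0 sqrtr_sqr. Qed.

Lemma continuous_real_complex : continuous (fun x : R => x%:C%C : C).
Proof.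
move=> x; apply/cvgrPdist_lt => e e0.
have eE : e = (complex.Re e)%:C%C by rewrite RRe_real // gtr0_real.
have e'0 : 0 < complex.Re e by rewrite -ltcR -eE.
near=> t; rewrite -rmorphB norm_real_complex eE ltcR.
by near: t; exists (complex.Re e).
Unshelve. all: by end_near. Qed.

Lemma meromorphic_identity f g a b :
  (forall x, meromorphic_at f x) -> (forall x, meromorphic_at g x) ->
  (\forall s \near a^', f s = g s) -> \forall s \near b^', f s = g s.
Proof.
move=> mf mg ab.
(* The line through a (at t = 0) and b (at t = 1) reduces connectedness of the plane to that of
   R. *)
pose gam (t : R) : C := a + t%:C%C * (b - a).
have gamC : continuous gam.
  move=> t; apply: cvgD; first exact: cvg_cst.
  by apply: cvgM; [exact: continuous_real_complex|exact: cvg_cst].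
pose U := [set x : C | \forall s \near x^', f s = g s].
pose V := [set x : C | \forall s \near x^', f s != g s].
have oU : open U by rewrite openE => x /near_dnbhs_open.
have oV : open V by rewrite openE => x /near_dnbhs_open.
have UV : U = ~` V.
  apply/seteqP; split=> x /=.
    move=> Ux Vx; have [s [/= -> /negP]] := filter_ex (filterI Ux Vx).
    by rewrite eqxx.
  move=> nVx; have [Ux|Vx] := meromorphic_at_dichotomy (mf x) (mg x).
    exact: Ux.
  by case: (nVx Vx).
have cR : connected [set: R] by apply/connected_intervalP.
have : gam @^-1` U = [set: R].
  apply: cR.
  - by exists 0; rewrite /= /gam mul0r addr0.
  - exists (gam @^-1` U); last by rewrite setTI.
    by apply: open_comp => // t _; exact: gamC.
  - exists (gam @^-1` U); last by rewrite setTI.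
    rewrite UV; apply: closed_comp => [t _|]; first exact: gamC.
    exact: open_closedC.
move=> /seteqP[_ /(_ 1 I)]; by rewrite /= /gam mul1r addrC subrK.
Qed.

(** The identity theorem gives agreement only on a punctured neighbourhood of b. There f has the
    finite limit g b, which fixes f b if f is analytic; at a pole it would make the leading
    coefficient the limit of (s - b)^n g s, that is, 0. *)
Lemma meromorphic_unique f g a b : meromorphic f -> meromorphic g ->
  (\forall s \near a, f s = g s) -> analytic_at g b -> f b = g b.
Proof.
move=> mf mg /(@nbhs_dnbhs _ a) fga /analytic_expands[e ge gb].
have fgb : \forall s \near b^', f s = g s.
  by apply: meromorphic_identity fga; exact: meromorphicP.
have gl : g @ b^' --> g b by rewrite gb; exact: expands_cvg.
have [/analytic_expands[c fc fb]|[n [c [n0 c0 fc]]]] := mf b.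
  have gf : \forall s \near b^', g s = f s by apply: filterS fgb.
  have := expands_cvg (expands_eq fgb fc); rewrite -fb => fl.
  exact: cvg_unique fl gl.
case/eqP: c0.
have h : expands (fun s => (s - b) ^+ n * g s) b c.
  by apply: expands_eq fc; apply: filterS fgb => s ->.
have h0 : (fun s => (s - b) ^+ n * g s) @ b^' --> (0 : C).
  rewrite -[0](mul0r (g b)); apply: cvgM; last exact: gl.
  by have := expands_cvg (expandsX b n); rewrite eq_sym (gtn_eqF n0).
exact: cvg_unique (expands_cvg h) h0.
Qed.

(** As long as the constant term vanishes, one factor s - a cancels and the exponent drops. *)
Lemma removable_or_pole f a n c : expands (fun s => (s - a) ^+ n * f s) a c ->
  (exists e, expands f a e) \/ pole_at f a.
Proof.
elim: n c => [|n IHn] c fc.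
  by left; exists c; apply: expands_eq fc; apply: nearW => s; rewrite mul1r.
have [c0|c0] := eqVneq (c 0%N) 0; last by right; exists n.+1, c.
apply: (IHn (fun k => c k.+1)); apply: expands_eq (expands_shift fc).
apply: filterS (nbhs_dnbhs_neq a) => s sa.
by rewrite c0 subr0 exprSr mulrAC mulfK // subr_eq0.
Qed.

Lemma meromorphic_at_quotient P Q a c e : expands P a c -> expands Q a e ->
  ~ (\forall s \near a^', Q s = 0) -> meromorphic_at (fun s => P s / Q s) a.
Proof.
move=> Pc Qe Q0; have [/(expands0 Qe)//|[m em ej]] := first_nonzero_coef e.
(* m is the order of the zero of Q at a, so Q / (s - a)^m has the nonzero constant term e m and can
   be inverted. *)
exists m; have g := expands_factor Qe ej.
have em' : e (m + 0)%N != 0 by rewrite addn0.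
have := expandsM Pc (expandsV em' g); set d := cauchy_prod _ _ => h.
exists d; apply: expands_eq h; apply: nearW => s.
by rewrite invf_div mulrCA.
Qed.

Lemma meromorphic_quotient P Q :
  (forall a, analytic_at P a) -> (forall a, analytic_at Q a) -> (exists a, Q a != 0) ->
  exists2 f, meromorphic f &
    forall a, Q a != 0 -> analytic_at f a /\ f a = P a / Q a.
Proof.
move=> Pan Qan [a0 Qa0].
(* If Q vanished around some point, the identity theorem would make it vanish around a0, against Q
   a0 != 0 and continuity. *)
have Qiso a : ~ (\forall s \near a^', Q s = 0).
  move=> Qa; have m0 x : meromorphic_at (fun _ => 0 : C) x.
    by exists 0%N; eexists; apply: expands_eq (expands_cst 0 x); apply: nearW => s; rewrite mulr0.
  have mQ x : meromorphic_at Q x by apply: meromorphicP => y; left.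
  have Q0 := meromorphic_identity a0 mQ m0 Qa.
  have [e Qe Qa0E] := analytic_expands (Qan a0).
  have Qn : \forall s \near a0^', Q s != 0.
    by apply: cvgr_neq0 _ (expands_cvg Qe) _; rewrite -Qa0E.
  by have [s [/= -> /eqP]] := filter_ex (filterI Q0 Qn).
(* Division by zero gives q the value 0 at the zeros of Q, which may spoil analyticity at a
   removable singularity. *)
pose q s := P s / Q s.
(* At a removable zero of Q the value is the constant term of the expansion of P / Q. *)
pose f s := if Q s != 0 then q s else xget 0 [set v | exists2 c, c 0%N = v & expands q s c].
have fq a : \forall s \near a^', q s = f s.
  have [e Qe _] := analytic_expands (Qan a).
  have [/Qiso//|] := expands_isolated_zeros Qe.
  by apply: filterS => s Qs; rewrite /f Qs.
have fan a : Q a != 0 -> analytic_at f a.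
  move=> Qa; have : analytic_at q a by apply: analyticM => //; exact: analyticV.
  move=> /analytic_expands[c qc qa]; apply: expands_analytic (expands_eq (fq a) qc) _.
  by rewrite /f Qa.
exists f; last by move=> a Qa; split; [exact: fan|rewrite /f Qa].
move=> a; have [Qa0'|/fan] := eqVneq (Q a) 0; last by left.
have [c Pc _] := analytic_expands (Pan a); have [e Qe _] := analytic_expands (Qan a).
have [n [d]] := meromorphic_at_quotient Pc Qe (Qiso a).
move=> /removable_or_pole[[h qh]|[m [h [m0 h0 qh]]]].
  left; rewrite -/q in qh.
  (* [xget] picks the constant term of some expansion of q, and that same expansion witnesses
     analyticity of f. *)
  have := @xgetPex _ (0 : C) [set v | exists2 c, c 0%N = v & expands q a c].
  move=> /(_ (ex_intro _ _ (ex_intro2 _ _ h erefl qh))) [k k0 qk].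
  apply: expands_analytic (expands_eq (fq a) qk) _.
  by rewrite /f Qa0' eqxx.
right; exists m, h; split; [exact: m0|exact: h0|].
apply: (@expands_eq _ (fun s => (s - a) ^+ m * q s)); last exact: qh.
by apply: filterS (fq a) => s <-.
Qed.

End Meromorphic.

(** * Complex powers *)

Section ComplexPower.
Variable R : realType.
Local Notation C := (R[i]^o).
Implicit Types (x y : R) (s t : C).

Lemma cpowD x s t : 0 < x -> cpow x (s + t) = cpow x s * cpow x t.
Proof.
move=> x0; case: s => s1 s2; case: t => t1 t2; rewrite /cpow /=.
rewrite !mulrDl cosD sinD powRD ?(gt_eqF x0) ?implybT //.
by apply/eqP; rewrite eq_complex /=; apply/andP; split; apply/eqP; ring.
Qed.

Lemma cpowM x y s : 0 < x -> 0 < y -> cpow (x * y) s = cpow x s * cpow y s.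
Proof.
move=> x0 y0; rewrite /cpow lnM ?posrE // powRM ?ltW // !mulrDr cosD sinD.
by apply/eqP; rewrite eq_complex /=; apply/andP; split; apply/eqP; ring.
Qed.

Lemma cpow1 s : cpow 1 s = 1.
Proof. by rewrite /cpow ln1 mulr0 cos0 sin0 powR1 mulr1 mulr0. Qed.

Lemma cpowX x n s : 0 < x -> cpow (x ^+ n) s = cpow x s ^+ n.
Proof.
move=> x0; elim: n => [|n IHn]; first exact: cpow1.
by rewrite exprS cpowM ?exprn_gt0 // IHn exprS.
Qed.

Lemma norm_cpow x s : `|cpow x s| = (x `^ complex.Re s)%:C%C.
Proof.
rewrite normc_def /= !exprMn -mulrDr cos2Dsin2 mulr1 sqrtr_sqr ger0_norm //.
exact: powR_ge0.
Qed.

Lemma cvg_complex (u v : nat -> R) (a b : R) :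
  u @ \oo --> a -> v @ \oo --> b ->
  (fun n => (u n)%:C%C + (v n)%:C%C * 'i%C : C) @ \oo --> (a%:C%C + b%:C%C * 'i%C : C).
Proof.
move=> ua vb; apply: cvgD.
  exact: (continuous_cvg _ (continuous_real_complex (R:=R) (x:=a)) ua).
apply: cvgM; last exact: cvg_cst.
exact: (continuous_cvg _ (continuous_real_complex (R:=R) (x:=b)) vb).
Qed.

Lemma exp_imaginary_coeff (b : R) k :
  (b%:C%C * 'i%C) ^+ k / k`!%:R = (cos_coeff b k)%:C%C + (sin_coeff b k)%:C%C * 'i%C :> C.
Proof.
have sgn : 'i%C ^+ k = (if odd k then (-1) ^+ k./2 * 'i%C else (-1) ^+ k./2) :> R[i].
  rewrite -{1}[k]odd_double_half exprD -mul2n exprM sqr_i.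
  by case: (odd k); rewrite ?expr1 ?expr0 ?mul1r // mulrC.
rewrite exprMn sgn /cos_coeff /sin_coeff /=.
rewrite !rmorphM /= !fmorphV !rmorph_nat !rmorphXn /= rmorphN1.
case: (boolP (odd k)) => ok /=; rewrite ?mul0r ?mul1r ?add0r ?addr0; last first.
  by rewrite [_ ^+ k * _]mulrC.
(* [sin_coeff] carries the exponent k.-1./2, which equals k./2 for odd k. *)
have -> : k.-1./2 = k./2 by case: k ok {sgn} => //= k; rewrite uphalf_half => /negbTE ->.
by rewrite mulrA [_ ^+ k * _]mulrC mulrAC.
Qed.

Lemma series_real_complex (u : nat -> R) n :
  series (fun k => (u k)%:C%C : C) n = (series u n)%:C%C.
Proof. by rewrite /series /= rmorph_sum. Qed.

(** Euler's formula near 0: the series of exp a and of exp (i b) are multiplied, and the binomial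
    theorem identifies the Cauchy product. The radius 1/8 is the one the product estimate asks
    for. *)
Lemma cvg_cexp (w : C) : `|w| <= 8^-1 ->
  series (fun k => w ^+ k / k`!%:R) @ \oo -->
    ((expR (complex.Re w))%:C%C * ((cos (complex.Im w))%:C%C + (sin (complex.Im w))%:C%C * 'i%C) : C).
Proof.
case: w => a b /= wn.
have hle (z : C) : `|z| <= 8^-1 -> forall k, `|z ^+ k / k`!%:R| <= 1 * 8^-1 ^+ k.
  move=> z8 k; rewrite mul1r normrM normrX normfV normr_nat.
  rewrite ler_pdivrMr ?ltr0n ?fact_gt0 //.
  apply: (@le_trans _ _ (8^-1 ^+ k)).
    by rewrite lerXn2r // nnegrE invr_ge0.
  by rewrite ler_peMr ?exprn_ge0 ?invr_ge0 // ler1n fact_gt0.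
have na : `|a%:C%C : C| <= 8^-1.
  by apply: le_trans wn; rewrite norm_real_complex; exact: (normc_ge_Re (a +i* b)%C).
have nb : `|b%:C%C * 'i%C : C| <= 8^-1.
  apply: le_trans wn; rewrite normrM norm_real_complex.
  have -> : `|'i%C : R[i]| = 1 by rewrite normc_def /= expr0n expr1n add0r sqrtr1.
  rewrite mulr1 normc_def /= -sqrtr_sqr lecR ler_wsqrtr // lerDr sqr_ge0 //.
have ha : series (fun k => a%:C%C ^+ k / k`!%:R) @ \oo --> ((expR a)%:C%C : C).
  have h : series (exp_coeff a) @ \oo --> expR a by exact: is_cvg_series_exp_coeff.
  apply: cvg_trans (continuous_cvg _ (continuous_real_complex (x:=expR a)) h).
  apply: near_eq_cvg; apply: nearW => n; rewrite /= -series_real_complex.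
  by apply: eq_bigr => k _; rewrite /exp_coeff /= rmorphM rmorphXn fmorphV rmorph_nat.
have hb : series (fun k => (b%:C%C * 'i%C) ^+ k / k`!%:R) @ \oo -->
    ((cos b)%:C%C + (sin b)%:C%C * 'i%C : C).
  have hc : series (cos_coeff b) @ \oo --> cos b by rewrite unlock; exact: is_cvg_series_cos_coeff.
  have hs : series (sin_coeff b) @ \oo --> sin b by rewrite unlock; exact: is_cvg_series_sin_coeff.
  apply: cvg_trans (cvg_complex hc hs); apply: near_eq_cvg; apply: nearW => n.
  rewrite -!series_real_complex /series /= mulr_suml -big_split /=.
  by apply: eq_bigr => k _; rewrite exp_imaginary_coeff.
have := cvg_cauchy_prod (hle _ na) (hle _ nb) ha hb.
set x := cauchy_prod _ _; have -> // : x = (fun k => (a +i* b)%C ^+ k / k`!%:R).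
apply/funext => k; rewrite /x /cauchy_prod.
have -> : (a +i* b)%C = b%:C%C * 'i%C + a%:C%C by rewrite [LHS]complexE /= addrC mulrC.
rewrite exprDn mulr_suml; apply: eq_bigr => i _; have ik := leq_ord i.
rewrite -[X in X / k`!%:R]mulr_natr -(bin_fact ik) !natrM !invfM [X in _ = X]mulrA mulfK; last first.
  by rewrite pnatr_eq0 -lt0n bin_gt0.
by rewrite mulrACA [X in X * _]mulrC.
Qed.

(** By [cpowD] only the expansion of x^u at u = 0 is at stake, where x^u = exp (u ln x). *)
Lemma analytic_cpow x s : 0 < x -> analytic_at (cpow x) s.
Proof.
move=> x0; exists (fun k => cpow x s * ((ln x)%:C%C ^+ k / k`!%:R)).
(* The added 1 keeps the rate positive when x = 1. *)
have r0 : 0 < `|(ln x)%:C%C : C| + 1 by rewrite ltr_wpDl.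
apply: filterS (near_scaled s r0) => t; set u := t - s => ur.
rewrite -[t](subrK s) addrC -/u cpowD //; apply: power_series_sumZ.
have wn : `|(ln x)%:C%C * u : C| <= 8^-1.
  apply: le_trans ur; rewrite normrM mulrC ler_wpM2l // lerDl //.
have := cvg_cexp wn; rewrite /has_power_series_sum.
have -> : (fun k => ((ln x)%:C%C * u : C) ^+ k / k`!%:R) =
          (fun k => (ln x)%:C%C ^+ k / k`!%:R * u ^+ k).
  by apply/funext => k; rewrite exprMn mulrAC.
suff E : (expR (complex.Re ((ln x)%:C%C * u)))%:C%C *
  ((cos (complex.Im ((ln x)%:C%C * u)))%:C%C + (sin (complex.Im ((ln x)%:C%C * u)))%:C%C * 'i%C)
  = cpow x u.
  by rewrite E; apply.
move: (gt_eqF x0) => x0'; clearbody u; clear -x0'; case: u => a b; rewrite /cpow /= /powR x0'.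
rewrite !mul0r subr0 addr0 !(mulrC (ln x)).
by apply/eqP; rewrite eq_complex /=; apply/andP; split; apply/eqP; ring.
Qed.

End ComplexPower.

(** * The p-adic absolute value and Haar measure *)

Section PadicAbsoluteValue.
Variables (R : realType) (p : nat) (p_pr : prime p).
Local Notation Zp := (padic_int p_pr).
Local Notation Qp := (padic p_pr).
Local Notation abs := (@padic_abs R p p_pr).
Local Notation iabs := (@padic_int_abs R p p_pr).
Local Notation Zball := (@padic_unit_ball R p p_pr).
Implicit Types (a b u v : Zp) (x y z : Qp).

Let p_gt0 : 0 < p%:R :> R. Proof. by rewrite ltr0n prime_gt0. Qed.
Let p_gt1 : 1 < p%:R :> R. Proof. by rewrite ltr1n prime_gt1. Qed.

Lemma padic_fracP x : exists u v, v != 0 /\ x = tofrac u / tofrac v.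
Proof.
exists (repr x).1, (repr x).2; split; first exact: denom_ratioP.
set f := repr x; rewrite -[LHS]reprK -/f; unlock tofrac.
rewrite -[X in _ * X]FracField.pi_inv -[RHS]FracField.pi_mul.
rewrite /FracField.invf /FracField.mulf !numden_Ratio ?oner_neq0 ?mul1r ?denom_ratioP //.
by rewrite mulr1 Ratio_numden.
Qed.

Lemma valuation_ge u n : u != 0 -> (n <= valuation u)%N = (u n == 0%N).
Proof.
move=> u0; apply/idP/eqP => [nv|un].
  by rewrite (residue_le u nv) (valuationP u0).1 mod0n.
by rewrite leqNgt; apply/negP => /(logn_residue u0)[].
Qed.

Lemma padic_int_abs_le u n : (iabs u <= p%:R ^- n) = (u n == 0%N).
Proof.
rewrite /padic_int_abs; have [->|u0] := eqVneq u 0.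
  by rewrite residue0 eqxx invr_ge0 exprn_ge0 // ltW.
rewrite -valuation_ge // lef_pV2 ?posrE ?exprn_gt0 //.
by rewrite ler_eXn2l.
Qed.

Lemma padic_int_abs_ge0 u : 0 <= iabs u.
Proof. by rewrite /padic_int_abs; case: ifP => // _; rewrite invr_ge0 exprn_ge0 // ltW. Qed.

Lemma padic_int_abs_eq0 u : (iabs u == 0) = (u == 0).
Proof.
rewrite /padic_int_abs; have [_|u0] := eqVneq u 0; first by rewrite eqxx.
by rewrite invr_eq0 expf_eq0 (gt_eqF p_gt0) andbF.
Qed.

Lemma padic_int_absD u v : iabs (u + v) <= Num.max (iabs u) (iabs v).
Proof.
have [->|u0] := eqVneq u 0; first by rewrite add0r le_max lexx orbT.
have [->|v0] := eqVneq v 0; first by rewrite addr0 le_max lexx.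
pose n := minn (valuation u) (valuation v).
have h : iabs (u + v) <= p%:R ^- n.
  rewrite padic_int_abs_le /=.
  have /eqP -> : u n == 0%N by rewrite -valuation_ge // geq_minl.
  have /eqP -> : v n == 0%N by rewrite -valuation_ge // geq_minr.
  by rewrite mod0n.
apply: le_trans h _; rewrite le_max /padic_int_abs (negbTE u0) (negbTE v0).
by rewrite /n /minn; case: ifP => _; rewrite lexx ?orbT.
Qed.

Lemma padic_abs_ge0 x : 0 <= abs x.
Proof.
have [u [v [v0 ->]]] := padic_fracP x.
by rewrite padic_absE // divr_ge0 ?padic_int_abs_ge0.
Qed.

Lemma tofrac_neq0 v : v != 0 -> tofrac v != 0 :> Qp.
Proof. by rewrite tofrac_eq0. Qed.

Lemma padic_abs_eq0 x : (abs x == 0) = (x == 0).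
Proof.
have [u [v [v0 ->]]] := padic_fracP x.
rewrite padic_absE // !mulf_eq0 !invr_eq0 !padic_int_abs_eq0 (negbTE v0).
by rewrite (negbTE (tofrac_neq0 v0)) tofrac_eq0.
Qed.

Lemma padic_absM x y : abs (x * y) = abs x * abs y.
Proof.
have [u [v [v0 ->]]] := padic_fracP x; have [a [b [b0 ->]]] := padic_fracP y.
rewrite !padic_absE // mulrACA -invfM -!tofracM padic_absE ?mulf_neq0 //.
by rewrite !padic_int_absM invfM mulrACA.
Qed.

Lemma padic_absD x y : abs (x + y) <= Num.max (abs x) (abs y).
Proof.
have [u [v [v0 ->]]] := padic_fracP x; have [a [b [b0 ->]]] := padic_fracP y.
rewrite addf_div ?tofrac_neq0 // -!tofracM -tofracD.
rewrite !padic_absE ?mulf_neq0 // padic_int_absM.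
have vb : 0 < iabs v * iabs b.
  by rewrite mulr_gt0 // lt_def padic_int_abs_eq0 ?v0 ?b0 padic_int_abs_ge0.
rewrite ler_pdivrMr //; apply: le_trans (padic_int_absD _ _) _.
rewrite !padic_int_absM maxr_pMl ?(ltW vb) //.
have nv : iabs v != 0 by rewrite padic_int_abs_eq0.
have nb : iabs b != 0 by rewrite padic_int_abs_eq0.
by rewrite mulrA divfK // [iabs v * _]mulrC mulrA divfK.
Qed.

Lemma padic_abs_tofrac u : abs (tofrac u) = iabs u.
Proof.
have := @padic_absE R p p_pr u 1 (oner_neq0 _); rewrite tofrac1 divr1 => ->.
suff -> : iabs 1 = 1 by rewrite divr1.
have n0 : iabs 1 != 0 by rewrite padic_int_abs_eq0 oner_neq0.
by apply: (mulfI n0); rewrite -padic_int_absM !mulr1.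
Qed.

Lemma padic_abs0 : abs 0 = 0.
Proof. by apply/eqP; rewrite padic_abs_eq0. Qed.

Lemma padic_abs1 : abs 1 = 1.
Proof.
have n0 : abs 1 != 0 by rewrite padic_abs_eq0 oner_neq0.
by apply: (mulfI n0); rewrite -padic_absM !mulr1.
Qed.

Lemma padic_absN x : abs (- x) = abs x.
Proof.
suff N1 : abs (-1) = 1 by rewrite -mulN1r padic_absM N1 mul1r.
have /eqP : abs (-1) ^+ 2 = 1 by rewrite expr2 -padic_absM mulrNN mulr1 padic_abs1.
by rewrite sqrp_eq1 ?padic_abs_ge0 // => /eqP.
Qed.

Lemma padic_absV x : abs x^-1 = (abs x)^-1.
Proof.
have [->|x0] := eqVneq x 0; first by rewrite invr0 padic_abs0 invr0.
have nx : abs x != 0 by rewrite padic_abs_eq0.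
by apply: (mulfI nx); rewrite -padic_absM !divff // padic_abs1.
Qed.

Lemma padic_abs_distC x y : abs (x - y) = abs (y - x).
Proof. by rewrite -padic_absN opprB. Qed.

Lemma padic_abs_le_add x y e : abs x <= e -> abs y <= e -> abs (x + y) <= e.
Proof. by move=> xe ye; apply: le_trans (padic_absD _ _) _; rewrite ge_max xe. Qed.

Lemma padic_abs1B x : abs x < 1 -> abs (1 - x) = 1.
Proof.
move=> x1; apply/eqP; rewrite eq_le; apply/andP; split.
  by apply: padic_abs_le_add; rewrite ?padic_absN ?padic_abs1 // ltW.
rewrite leNgt; apply/negP => h; have := padic_absD (1 - x) x.
rewrite subrK padic_abs1 le_max !leNgt h /= => /negP; exact.
Qed.

Lemma padic_unit_ballP x : Zball x <-> abs x <= 1.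
Proof. by rewrite /padic_unit_ball /padic_ball /= subr0. Qed.

Lemma padic_ball_center (x : Qp) (e : R) : 0 <= e -> padic_ball x e x.
Proof. by move=> e0; rewrite /padic_ball /= subrr padic_abs0. Qed.

(** By the ultrametric inequality every point of a ball is a centre, so one common point decides
    inclusion. *)
Lemma padic_ball_sub x y (e f : R) z : e <= f -> padic_ball x e z -> padic_ball y f z ->
  padic_ball x e `<=` padic_ball y f.
Proof.
move=> ef xz yz t xt; rewrite /padic_ball /= in xz yz xt *.
have -> : t - y = (t - x) + ((x - z) + (z - y)) by rewrite !addrA !subrK.
apply: padic_abs_le_add; first exact: le_trans xt ef.
by apply: padic_abs_le_add => //; rewrite padic_abs_distC; exact: le_trans xz ef.
Qed.

Lemma padic_ball_nested A B z : is_padic_ball R A -> is_padic_ball R B -> A z -> B z ->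
  A `<=` B \/ B `<=` A.
Proof.
move=> [a [n ->]] [b [m ->]] Az Bz.
have [nm|mn] := leP ((p%:R : R) ^ n) (p%:R ^ m); [left|right].
  exact: padic_ball_sub nm Az Bz.
exact: padic_ball_sub (ltW mn) Bz Az.
Qed.

Lemma is_padic_ball_nonempty (A : set Qp) : is_padic_ball R A -> A !=set0.
Proof.
move=> [a [n ->]]; exists a; apply: padic_ball_center.
by apply: exprz_ge0; rewrite ltW.
Qed.

Lemma is_padic_ball_unit : is_padic_ball R Zball.
Proof. by exists 0, 0. Qed.

Lemma affine_ball (al be a : Qp) (e : R) : al != 0 ->
  [set al * x + be | x in padic_ball a e] = padic_ball (al * a + be) (abs al * e).
Proof.
move=> al0; have pal : 0 < abs al by rewrite lt_def padic_abs_eq0 al0 padic_abs_ge0.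
apply/seteqP; split => [_ [x xa <-]|y]; rewrite /padic_ball /=.
  by rewrite opprD addrACA subrr addr0 -mulrBr padic_absM ler_pM2l.
move=> h; exists ((y - be) / al); last by rewrite mulrC divfK // subrK.
rewrite -(ler_pM2l pal) -padic_absM mulrBr mulrC divfK //.
by rewrite -addrA -opprD [be + _]addrC.
Qed.

Lemma residue_nat k n : (k%:R : Zp) n = (k %% p ^ n)%N.
Proof.
elim: k => [|k IHk]; first by rewrite residue0 mod0n.
by rewrite -addn1 natrD /= IHk modnDm.
Qed.

Lemma residue_sub u v n : ((u - v : Zp) n == 0%N) = (u n == v n).
Proof.
apply/idP/idP => [/eqP h|/eqP h].
  have : (((u - v)%R n + v n) %% p ^ n)%N = u n := congr1 (fun w : Zp => w n) (subrK v u).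
  by rewrite h add0n residue_mod => ->.
have e0 : (v - v : Zp) n = 0%N by rewrite subrr residue0.
by rewrite -[X in _ == X]e0 /= h.
Qed.

Lemma tofrac_nat k : tofrac (k%:R : Zp) = k%:R :> Qp.
Proof. exact: rmorph_nat. Qed.

Lemma padic_nat_dist i j l : (i < p ^ l)%N -> (j < p ^ l)%N ->
  abs (i%:R - j%:R) <= p%:R ^- l -> i = j.
Proof.
move=> ip jp; rewrite -!tofrac_nat -tofracB padic_abs_tofrac padic_int_abs_le.
by rewrite residue_sub !residue_nat !modn_small // => /eqP.
Qed.

(* With x = u / v, the integer i solves i (v / p^w) = u / p^w modulo p^l, w = val v. *)
Lemma padic_approx x l : abs x <= 1 -> exists2 i, (i < p ^ l)%N & abs (x - i%:R) <= p%:R ^- l.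
Proof.
case: l => [|l] x1.
  by exists 0%N; rewrite ?expn0 // subr0 expr0 invr1.
have [u [v [v0 xE]]] := padic_fracP x; set w := valuation v.
have pv : 0 < iabs v by rewrite lt_def padic_int_abs_eq0 v0 padic_int_abs_ge0.
have uv : iabs u <= p%:R ^- w.
  move: x1; rewrite xE padic_absE // ler_pdivrMr // mul1r.
  by rewrite {1}/padic_int_abs [iabs v]/padic_int_abs (negbTE v0).
(* Dividing by v loses w digits, hence the numerator is controlled modulo p^(w + l + 1). *)
pose L := (w + l.+1)%N.
have wL : (w < L)%N by rewrite /L addnS ltnS leq_addr.
have [/eqP vL lv] := logn_residue v0 wL.
have [V [VE cV]] : exists V, v L = (V * p ^ w)%N /\ coprime p V.
  have vL0 : (0 < v L)%N by rewrite lt0n.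
  by have [V cV VE] := pfactor_coprime p_pr vL0; exists V; rewrite VE lv.
have [U UE] : exists U, u L = (U * p ^ w)%N.
  apply/dvdnP; rewrite /dvdn -(residue_le u (ltnW wL)).
  by rewrite -padic_int_abs_le.
have cVp : coprime V (p ^ l.+1) by rewrite coprime_sym coprimeXl.
(* t is divisible by V and congruent to U modulo p^(l + 1); its quotient by V is the integer
   sought. *)
pose t := chinese V (p ^ l.+1) 0 U.
have [i iE] : exists i, t = (i * V)%N.
  by apply/dvdnP; rewrite /dvdn chinese_modl // mod0n.
exists (i %% p ^ l.+1)%N; first by rewrite ltn_mod expn_gt0 prime_gt0.
set j := (i %% _)%N.
have -> : x - j%:R = tofrac (u - j%:R * v) / tofrac v.
  by rewrite xE tofracB tofracM tofrac_nat mulrBl mulfK // tofrac_eq0.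
rewrite padic_absE // ler_pdivrMr //.
have -> : iabs v = p%:R ^- w by rewrite /padic_int_abs (negbTE v0).
rewrite -invfM -exprD addnC padic_int_abs_le residue_sub -/L.
apply/eqP; rewrite /= residue_nat VE UE.
have q0 : (0 < p ^ w)%N by rewrite expn_gt0 prime_gt0.
have LE : (p ^ L = p ^ l.+1 * p ^ w)%N by rewrite /L expnD mulnC.
have Up : (U < p ^ l.+1)%N.
  by rewrite -(ltn_pmul2r q0) -UE -LE -residue_mod ltn_mod expn_gt0 prime_gt0.
rewrite modnMml mulnA LE -muln_modl; congr (_ * _)%N.
by rewrite /j modnMml -iE chinese_modr // modn_small.
Qed.

Lemma padic_ball_translate (x : Qp) (e : R) :
  [set x + y | y in padic_ball 0 e] = padic_ball x e.
Proof.
have := @affine_ball 1 x 0 e (oner_neq0 _).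
rewrite mulr0 add0r padic_abs1 mul1r => <-.
by apply: eq_imagel => y _; rewrite mul1r addrC.
Qed.

Lemma measurable_padic_ball (x : Qp) (e : R) : 0 < e ->
  measurable (padic_ball x e : set (padic_borel R p_pr)).
Proof.
move=> e0; apply: sub_sigma_algebra => y xy; exists e => //.
by apply: padic_ball_sub (lexx e) (padic_ball_center y (ltW e0)) xy.
Qed.

(** Z_p is the disjoint union of the p^l balls of radius p^-l centred at 0, ..., p^l - 1. They are
    translates of one another, so p^l m = 1, which also rules out an infinite m. *)
Lemma haar_ball (mu : {measure set (padic_borel R p_pr) -> \bar R}) x l :
  normalized_haar mu -> mu (padic_ball x (p%:R ^- l : R)) = (p%:R ^- l)%:E.
Proof.
move=> [inv mu1]; have e0 : 0 < p%:R ^- l :> R by rewrite invr_gt0 exprn_gt0.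
have muT y : mu (padic_ball y (p%:R ^- l : R)) = mu (padic_ball 0 (p%:R ^- l : R)).
  by rewrite -padic_ball_translate inv //; exact: measurable_padic_ball.
have cover : @padic_unit_ball R p p_pr =
    \bigcup_(i in `I_(p ^ l)) padic_ball (i%:R : Qp) (p%:R ^- l : R).
  apply/seteqP; split => [y /padic_unit_ballP/(padic_approx l)[i il yi]|y [i _ yi]].
    by exists i.
  apply/padic_unit_ballP; rewrite -[y](subrK i%:R); apply: padic_abs_le_add.
    apply: le_trans yi _; rewrite invf_le1 ?exprn_gt0 //.
    by rewrite exprn_ege1 // ltW.
  have := padic_int_abs_le i%:R 0.
  by rewrite expr0 invr1 residue_nat expn0 modn1 -padic_abs_tofrac tofrac_nat.
rewrite muT; set m := mu _.
have : mu (@padic_unit_ball R p p_pr) = ((p ^ l)%:R%:E * m)%E.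
  rewrite cover measure_fin_bigcup; first 1 last.
  - exact: finite_II.
  - apply/trivIsetP => i j /= ip jp ij; apply/seteqP; split=> // y [yi yj].
    case/eqP: ij; apply: (padic_nat_dist ip jp).
    have -> : i%:R - j%:R = (i%:R - y) + (y - j%:R) by rewrite addrA subrK.
    by apply: padic_abs_le_add => //; rewrite padic_abs_distC.
  - by move=> i _; exact: measurable_padic_ball.
  rewrite -fsbig_ord (eq_bigr (fun=> m)); last by move=> i _; exact: muT.
  by rewrite sumr_const card_ord mule_natl.
rewrite mu1 => mE; have m0 : (0 <= m)%E by exact: measure_ge0.
have n0 : (0 : R) < (p ^ l)%:R by rewrite ltr0n expn_gt0 prime_gt0.
move: m0 mE; case: m => [q _ [qE]| _ |//].
  by congr _%:E; apply: (mulfI (lt0r_neq0 n0)); rewrite -qE natrX divff // gt_eqF // exprn_gt0.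
by rewrite gt0_muley.
Qed.

End PadicAbsoluteValue.

(** * Convex components of a self-similar string *)

Section SelfSimilarString.
Variables (R : realType) (p : nat) (p_pr : prime p).
Local Notation Qp := (padic p_pr).
Local Notation abs := (@padic_abs R p p_pr).
Local Notation Zball := (@padic_unit_ball R p p_pr).

Lemma affine_similarity_contractionP (Phi : Qp -> Qp) (r : R) :
  affine_similarity_contraction Phi r ->
  exists a b, [/\ abs a = r, abs b <= 1, 0 < r < 1 &
    forall x, Zball x -> Phi x = a * x + b].
Proof.
move=> [[a [b [_ /padic_unit_ballP b1 PhiE]]] r01 Phir]; exists a, b; split=> //.
have Z0 : Zball 0 by apply/padic_unit_ballP; rewrite padic_abs0.
have Z1 : Zball 1 by apply/padic_unit_ballP; rewrite padic_abs1.
(* Comparing the images of 1 and 0 identifies the ratio with |a|. *)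
have := Phir 1 0 Z1 Z0; rewrite !PhiE // mulr1 mulr0 add0r addrK subr0.
by rewrite padic_abs1 mulr1.
Qed.

Variables (mu : {measure set (padic_borel R p_pr) -> \bar R}).
Variables (mu_haar : normalized_haar mu) (N K : nat).
Variables (Phi : 'I_N -> Qp -> Qp) (r : 'I_N -> R) (G : 'I_K -> set Qp) (g : 'I_K -> R).
Hypothesis system : self_similar_system mu Phi r G g.

Local Notation gaps := (Zball `\` \bigcup_(j in [set: 'I_N]) (Phi j @` Zball)).
Local Notation word := (word_map Phi).
Local Notation L := (self_similar_string Phi G).

Let mapP j := affine_similarity_contractionP (system_map system j).

Lemma contraction_unit_ball j x : Zball x -> Zball (Phi j x).
Proof.
move=> Zx; have [a [b [ar b1 /andP[_ r1] PhiE]]] := mapP j.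
rewrite PhiE //; apply/padic_unit_ballP; apply: padic_abs_le_add => //.
rewrite padic_absM ar -[1]mulr1 ler_pM ?padic_abs_ge0 // ?(ltW r1) //.
  by rewrite -ar padic_abs_ge0.
exact/padic_unit_ballP.
Qed.

Lemma contraction_inj j x y : Zball x -> Zball y -> Phi j x = Phi j y -> x = y.
Proof.
move=> Zx Zy; have [a [b [ar b1 /andP[r0 _] PhiE]]] := mapP j.
rewrite !PhiE // => /addIr; apply: mulfI.
by rewrite -(@padic_abs_eq0 R) ar gt_eqF.
Qed.

Lemma contraction_disjoint i j x y : Zball x -> Zball y -> Phi i x = Phi j y -> i = j.
Proof.
move=> Zx Zy xy; have /trivIsetP tI := system_disjoint system.
apply: contrapT => /eqP ij.
have : (Phi i @` Zball `&` Phi j @` Zball) (Phi i x).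
  by split; [exists x|exists y].
by rewrite tI.
Qed.

Lemma contraction_fixpoint j : exists2 x, Zball x & Phi j x = x.
Proof.
have [a [b [ar b1 /andP[_ r1] PhiE]]] := mapP j.
have a1 : abs (1 - a) = 1 by apply: padic_abs1B; rewrite ar.
have a0 : 1 - a != 0 by rewrite -(@padic_abs_eq0 R) a1 oner_neq0.
have Zx : Zball (b / (1 - a)).
  by apply/padic_unit_ballP; rewrite padic_absM padic_absV a1 invr1 mulr1.
exists (b / (1 - a)) => //; rewrite PhiE //.
by apply: (mulIf a0); rewrite mulrDl -mulrA divfK // mulrBr mulr1 addrC mulrC subrK.
Qed.

(** The last letter is the outermost map, so words are taken apart from the right. *)
Lemma word_map_rcons w j x : word (rcons w j) x = Phi j (word w x).
Proof. by rewrite /word_map foldl_rcons. Qed.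

Lemma word_unit_ball w x : Zball x -> Zball (word w x).
Proof.
move=> Zx; elim/last_ind: w => //= w j IHw.
by rewrite word_map_rcons; exact: contraction_unit_ball.
Qed.

(** Outermost maps are peeled off in pairs, by disjointness and injectivity. If one word ran out
    first, a point of [gaps] would lie in some Phi_j(Z_p). *)
Lemma word_gaps_inj w v x y : gaps x -> gaps y -> word w x = word v y -> w = v /\ x = y.
Proof.
move=> gx gy; have [[Zx nx] [Zy ny]] := (gx, gy).
elim/last_ind: w v => [|w i IHw]; elim/last_ind=> [|v j _] //.
- rewrite word_map_rcons => xE; case: nx; exists j => //.
  by exists (word v y); [exact: word_unit_ball|rewrite -xE].
- rewrite word_map_rcons => yE; case: ny; exists i => //.
  by exists (word w x); [exact: word_unit_ball|rewrite yE].
rewrite !word_map_rcons => xy; have Zwx := word_unit_ball w Zx; have Zvy := word_unit_ball v Zy.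
have ij := contraction_disjoint Zwx Zvy xy; move: xy; rewrite -ij.
by move/(contraction_inj Zwx Zvy)/IHw => [-> ->].
Qed.

(* The images of a fixed point lie in images of Z_p under words of every length. *)
Lemma word_fixpoint_out w v j x y : Zball x -> Phi j x = x -> gaps y ->
  word w x <> word v y.
Proof.
move=> Zx xj gy; have [Zy ny] := gy.
(* Since x = Phi j x, even the empty word has an outermost map, so one can be peeled off as often as
   v requires. *)
have wE w' : exists v' i, word w' x = Phi i (word v' x).
  elim/last_ind: w' => [|w' i _]; first by exists [::], j; rewrite /= xj.
  by exists w', i; rewrite word_map_rcons.
elim/last_ind: v w => [|v i IHv] w; have [w' [i' ->]] := wE w => E.
  by case: ny; exists i' => //; exists (word w' x); [exact: word_unit_ball|].
move: E; rewrite word_map_rcons => E.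
have Zwx := word_unit_ball w' Zx; have Zvy := word_unit_ball v Zy.
have ij := contraction_disjoint Zwx Zvy E; move: E; rewrite ij.
by move/(contraction_inj Zwx Zvy); exact: IHv.
Qed.

Lemma generator_ball k : [/\ is_padic_ball R (G k), G k `<=` gaps &
  forall B, is_padic_ball R B -> G k `<=` B -> B `<=` gaps -> B = G k].
Proof. by have : range G (G k) by [exists k]; rewrite (system_gen system). Qed.

Lemma generator_unit_ball k : G k `<=` Zball.
Proof. by have [_ sub _] := generator_ball k => x /sub[]. Qed.

Lemma string_gaps x : L x -> exists w y, [/\ gaps y & x = word w y].
Proof.
move=> [w _ [k _ [y Gy <-]]]; exists w, y; split=> //.
by have [_ sub _] := generator_ball k; exact: sub.
Qed.

Variable n : 'I_N -> nat.
Hypothesis ratioE : forall j, r j = p%:R ^- n j.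

(** The exponent of the scaling ratio p^-(n_w1 + ... + n_wa) of the composite map, not the number of
    letters. *)
Definition word_length (w : seq 'I_N) : nat := \sum_(j <- w) n j.

Lemma word_affine w : exists a b, abs a = p%:R ^- word_length w /\
  forall x, Zball x -> word w x = a * x + b.
Proof.
elim/last_ind: w => [|w j [a [b [aE wE]]]].
  exists 1, 0; rewrite padic_abs1 /word_length big_nil expr0 invr1; split=> // x _.
  by rewrite mul1r addr0.
have [c [d [cr _ _ PhiE]]] := mapP j.
exists (c * a), (c * b + d); split.
  rewrite padic_absM cr aE ratioE /word_length -cats1 big_cat big_seq1 /=.
  by rewrite exprD invfM mulrC.
move=> x Zx; rewrite word_map_rcons PhiE; last exact: word_unit_ball.
by rewrite wE // mulrDr mulrA addrA.
Qed.

Let p_gt0 : 0 < p%:R :> R. Proof. by rewrite ltr0n prime_gt0. Qed.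

Lemma word_image_ball w (x : Qp) (e : R) : padic_ball x e `<=` Zball -> Zball x ->
  word w @` padic_ball x e = padic_ball (word w x) (p%:R ^- word_length w * e).
Proof.
move=> sub Zx; have [a [b [aE wE]]] := word_affine w.
have a0 : a != 0 by rewrite -(@padic_abs_eq0 R) aE invr_eq0 expf_eq0 gt_eqF // andbF.
rewrite wE // -aE -affine_ball //.
by apply: eq_imagel => y /sub Zy; rewrite wE.
Qed.

Lemma is_padic_ball_image w (B : set Qp) : is_padic_ball R B -> B `<=` Zball ->
  is_padic_ball R (word w @` B).
Proof.
move=> [x [z ->]] sub; exists (word w x), (z - (word_length w)%:Z).
rewrite word_image_ball //; last first.
  by apply: sub; apply: padic_ball_center; rewrite exprz_ge0 // ltW.
by rewrite expfzDr ?gt_eqF // mulrC -exprnN.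
Qed.

Lemma haar_word_generator w k m : g k = p%:R ^- m ->
  mu (word w @` G k) = (p%:R ^- (word_length w + m))%:E.
Proof.
move=> gE; have [[x [z GE]] _ _] := generator_ball k.
have gap := system_gap system k; rewrite gE in gap.
(* A ball may have any integer exponent z; if z > 0, G k would contain Z_p and have measure at least
   1. *)
have [l zl] : exists l : nat, z = - l%:Z.
  case: z GE => [[|l]|l] GE; [by exists 0%N| |by exists l.+1].
  have := system_gap_bounds system k; rewrite gE => /andP[_].
  suff : 1 <= p%:R ^- m :> R by rewrite leNgt => /negbTE ->.
  have mB (y : Qp) (e : R) := @measurable_padic_ball R p p_pr y e.
  rewrite -lee_fin -gap -(mu_haar.2) GE; apply: le_measure; rewrite ?inE; first exact: mB.
    by apply: mB; rewrite exprz_gt0.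
  have xG : G k x by rewrite GE; apply: padic_ball_center; rewrite exprz_ge0 // ltW.
  apply: (@padic_ball_sub R p p_pr 0 x 1 _ x) => //; last by rewrite -GE.
    by rewrite -exprnP exprn_ege1 // ler1n prime_gt0.
  exact: generator_unit_ball xG.
have xG : G k x by rewrite GE; apply: padic_ball_center; rewrite exprz_ge0 // ltW.
have GE' : G k = padic_ball x (p%:R ^- l : R) by rewrite GE zl exprnN.
have ml : p%:R ^- m = p%:R ^- l :> R.
  by apply: EFin_inj; rewrite -gap GE' haar_ball.
rewrite GE' word_image_ball -?GE'; last 2 first.
- exact: generator_unit_ball.
- exact: generator_unit_ball xG.
by rewrite -invfM -exprD haar_ball // !exprD !invfM ml.
Qed.

Lemma convex_components_string :
  convex_components R L = [set B | exists w k, B = word w @` G k].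
Proof.
have sub w k : word w @` G k `<=` L.
  by move=> x Gx; exists w => //; exists k.
have ballw w k : is_padic_ball R (word w @` G k).
  apply: is_padic_ball_image; last exact: generator_unit_ball.
  by case: (generator_ball k).
have N0 : 'I_N by exact: (Ordinal (ltnW (system_N system))).
have out w j x : Zball x -> Phi j x = x -> ~ L (word w x).
  move=> Zx xj /string_gaps[v [y [gy]]]; exact: word_fixpoint_out Zx xj gy.
have maxw w k B : is_padic_ball R B -> word w @` G k `<=` B -> B `<=` L -> B = word w @` G k.
  move=> bB GB BL.
  have [bG Ggaps maxG] := generator_ball k.
  have [a [b [aE wE]]] := word_affine w.
  have a0 : a != 0 by rewrite -(@padic_abs_eq0 R) aE invr_eq0 expf_eq0 gt_eqF // andbF.
  (* The affine extension of [word w] to all of Q_p is bijective, so B can be pulled back before it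
     is known to lie in the image of Z_p. *)
  pose f x : Qp := a * x + b.
  have fK y : f ((y - b) / a) = y by rewrite /f mulrC divfK // subrK.
  have finj : injective f by move=> x y /addIr /(mulfI a0).
  pose B' := f @^-1` B.
  have fB' : f @` B' = B.
    apply/seteqP; split => [_ [x Bx <-] //|y By]; exists ((y - b) / a); rewrite ?fK //.
    by rewrite /B' /= fK.
  have bB' : is_padic_ball R B'.
    have [c [z BE]] := bB.
    exists ((c - b) / a), (z + (word_length w)%:Z).
    have : f @` B' = f @` padic_ball ((c - b) / a) ((p%:R : R) ^ (z + (word_length w)%:Z)).
      rewrite fB' /f affine_ball // -/(f _) fK aE BE; congr padic_ball.
      by rewrite expfzDr ?gt_eqF // mulrC -mulrA mulfV ?mulr1 // expf_neq0 // gt_eqF.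
    move=> E; apply/seteqP; split => x Bx.
      have : (f @` B') (f x) by exists x.
      by rewrite E => -[y hy /finj <-].
    have : (f @` padic_ball ((c - b) / a) ((p%:R : R) ^ (z + (word_length w)%:Z))) (f x) by exists x.
    by rewrite -E => -[y hy /finj <-].
  have GB' : G k `<=` B'.
    move=> x Gx; apply: GB; exists x => //; rewrite wE //; exact: generator_unit_ball Gx.
  have nofix j x : Zball x -> Phi j x = x -> ~ B' x.
    move=> Zx xj; rewrite /B' /= /f -wE // => /BL; exact: (out _ j).
  have [y Gy] := is_padic_ball_nonempty bG.
  have Zy := generator_unit_ball Gy.
  have [B'Z|ZB'] := padic_ball_nested bB' (is_padic_ball_unit R p_pr) (GB' _ Gy) Zy; last first.
    have [x Zx xj] := contraction_fixpoint N0.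
    by case: (nofix _ x Zx xj (ZB' _ Zx)).
  have B'gaps : B' `<=` gaps.
    move=> x B'x; split; first exact: B'Z.
    move=> [j _ jx].
    have bj : is_padic_ball R (Phi j @` Zball).
      have := @is_padic_ball_image [:: j] _ (is_padic_ball_unit R p_pr).
      by apply.
    (* Inclusion of B' in Phi_j(Z_p) contradicts that G k avoids this image; the reverse inclusion
       puts the fixed point of Phi j into B'. *)
    have [sub1|sub2] := padic_ball_nested bB' bj B'x jx.
      have [_ nG] := Ggaps _ Gy; apply: nG; exists j => //; exact: sub1 _ (GB' _ Gy).
    have [z Zz zj] := contraction_fixpoint j.
    apply: (nofix _ z Zz zj); apply: sub2; exists z => //.
  have B'E := maxG _ bB' GB' B'gaps.
  rewrite -fB' B'E; apply: eq_imagel => x Gx; rewrite wE //; exact: generator_unit_ball Gx.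
apply/seteqP; split => B /=.
  move=> [bB BL maxB].
  (* A component meets some Phi_w(G_k), so the two balls are nested and the maximality of the
     smaller one gives equality. *)
  have [x Bx] := is_padic_ball_nonempty bB.
  have [w _ [k _ Gx]] := BL _ Bx; exists w, k.
  have [BG|GB] := padic_ball_nested bB (ballw w k) Bx Gx.
    by rewrite (maxB _ (ballw w k) BG).
  exact: maxw.
move=> [w [k ->]]; split=> //; exact: maxw.
Qed.

Lemma word_generator_inj w k v l : word w @` G k = word v @` G l -> w = v /\ k = l.
Proof.
move=> E; have [bG Gk maxk] := generator_ball k; have [_ Gl _] := generator_ball l.
have [y Gy] := is_padic_ball_nonempty bG.
have [z Gz zE] : (word v @` G l) (word w y) by rewrite -E; exists y.
have [wv _] := word_gaps_inj (Gk _ Gy) (Gl _ Gz) (esym zE).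
split=> //; apply: (system_gen_inj system).
apply/seteqP; split => x Gx.
  have [t Gt tE] : (word v @` G l) (word w x) by rewrite -E; exists x.
  by have [_ ->] := word_gaps_inj (Gk _ Gx) (Gl _ Gt) (esym tE).
have [t Gt tE] : (word w @` G k) (word v x) by rewrite E; exists x.
by have [_ ->] := word_gaps_inj (Gl _ Gx) (Gk _ Gt) (esym tE).
Qed.

End SelfSimilarString.

(** * The geometric zeta function *)

Section UnorderedSums.
Variable R : realType.
Local Notation C := (R[i]^o).

Lemma sum_subset_diff (T : eqType) (V : zmodType) (F : T -> V) (s t : seq T) :
  uniq s -> uniq t -> {subset s <= t} ->
  \sum_(x <- t) F x - \sum_(x <- s) F x = \sum_(x <- t | x \notin s) F x.
Proof.
move=> us ut st; rewrite (bigID (mem s)) /= -big_filter.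
have -> : \sum_(x <- [seq x <- t | x \in s]) F x = \sum_(x <- s) F x.
  apply: perm_big; apply: uniq_perm => // [|x]; first exact: filter_uniq.
  by rewrite mem_filter; apply: andb_idr; exact: st.
by rewrite addrAC subrr add0r.
Qed.

(** Reduces an unordered sum to an exhausting sequence of finite lists: [e a] bounds the absolute
    sum of everything that can be added after [D a]. *)
Lemma cvg_totally (T : choiceType) (P : pred T) (t : T -> C) (D : nat -> seq T)
    (e : nat -> C) (l : C) :
  (forall a, uniq (D a)) -> (forall a x, x \in D a -> P x) ->
  (forall a b, (a <= b)%N -> {subset D a <= D b}) -> (forall x, P x -> exists a, x \in D a) ->
  (forall a b, (a <= b)%N -> \sum_(x <- D b) `|t x| - \sum_(x <- D a) `|t x| <= e a) ->
  e @ \oo --> (0 : C) -> (fun a => \sum_(x <- D a) t x) @ \oo --> l ->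
  (fun J : {fset T} => \sum_(x <- J | P x) t x) @ totally --> l.
Proof.
move=> uD DP Dmono Dcov De e0 Dl; have FT := @totally_filter T; apply/cvgrPdist_lt => eps eps0.
have eps2 : 0 < eps / 2 by rewrite divr_gt0.
have /cvgr0Pnorm_lt /(_ _ eps2) h1 := e0.
have /cvgrPdist_lt /(_ _ eps2) h2 := Dl.
have [a [ea la]] := filter_ex (filterI h1 h2).
exists [fset x in D a]%fset => // J /= aJ.
have Ja x : x \in D a -> x \in J.
  by move=> xa; apply: (fsubsetP aJ); rewrite inE.
pose J' := [seq x <- J | P x].
have uJ' : uniq J' by apply: filter_uniq; exact: fset_uniq.
have DJ' : {subset D a <= J'}.
  by move=> x xa; rewrite mem_filter (DP _ _ xa); exact: Ja.
(* The finite list J' lies in some later D b, so its excess over D a is at most the tail e a. *)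
have [b ab J'b] : exists2 b, (a <= b)%N & {subset J' <= D b}.
  have : forall x, x \in J' -> P x by move=> x; rewrite mem_filter => /andP[].
  elim: (J') => [|x s IHs] sP; first by exists a.
  have [b ab sb] := IHs (fun y ys => sP y (@mem_behead _ (x :: s) y ys)).
  have [c xc] := Dcov _ (sP x (mem_head _ _)).
  exists (maxn b c); first by rewrite leq_max ab.
  move=> y; rewrite inE => /predU1P[->|/sb yb].
    by apply: Dmono xc; exact: leq_maxr.
  by apply: Dmono yb; exact: leq_maxl.
rewrite -big_filter -/J' -[X in l - X](subrK (\sum_(x <- D a) t x)) opprD addrCA addrA.
rewrite [eps]splitr -addrA addrC; apply: le_lt_trans (ler_normD _ _) _.
apply: ltrD; first exact: la.
rewrite normrN sum_subset_diff //; apply: le_lt_trans ea.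
apply: le_trans (ler_norm_sum _ _ _) _.
have ea0 : 0 <= e a by apply: le_trans (De a a (leqnn a)); rewrite subrr.
rewrite (ger0_norm ea0).
apply: le_trans (De a b ab); rewrite sum_subset_diff //; last exact: Dmono.
rewrite -big_filter -[leRHS]big_filter -subr_ge0 sum_subset_diff ?filter_uniq //.
  by apply: sumr_ge0.
move=> x; rewrite mem_filter => /andP[xa xJ]; rewrite mem_filter xa; exact: J'b.
Qed.

End UnorderedSums.

(** * Enumeration of words and generators by number of letters *)

Section Words.
Variables (N K : nat).

Fixpoint words (i : nat) : seq (seq 'I_N) :=
  if i is i'.+1 then [seq rcons w j | w <- words i', j <- enum 'I_N] else [:: [::]].

Lemma mem_words i w : (w \in words i) = (size w == i).
Proof.
elim: i w => [|i IHi] w; first by rewrite inE size_eq0.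
apply/allpairsP/eqP => [[[v j] [/= vi _ ->]]|].
  by rewrite size_rcons; move: vi; rewrite IHi => /eqP ->.
case/lastP: w => // v j; rewrite size_rcons => -[vi].
by exists (v, j); split; rewrite ?mem_enum // IHi vi.
Qed.

Lemma uniq_words i : uniq (words i).
Proof.
elim: i => [//|i IHi] /=; apply: allpairs_uniq => //; first exact: enum_uniq.
by move=> [v j] [w k] _ _ /= /rcons_inj[-> ->].
Qed.

Fixpoint indexes (a : nat) : seq (seq 'I_N * 'I_K) :=
  if a is a'.+1 then indexes a' ++ [seq (w, k) | w <- words a', k <- enum 'I_K] else [::].

Lemma mem_indexes a w k : ((w, k) \in indexes a) = (size w < a)%N.
Proof.
elim: a => [//|a IHa]; rewrite /= mem_cat IHa ltnS [in RHS]leq_eqVlt orbC; congr (_ || _).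
rewrite -mem_words; apply/allpairsP/idP => [[[v l] [/= va _ [-> _]]] //|wa].
by exists (w, k); split; rewrite ?mem_enum.
Qed.

Lemma uniq_indexes a : uniq (indexes a).
Proof.
elim: a => [//|a IHa] /=; rewrite cat_uniq IHa /=; apply/andP; split.
  apply/hasPn => -[w k] /allpairsP[[v l] [/= va _ [-> ->]]].
  by rewrite mem_indexes; move: va; rewrite mem_words => /eqP ->; rewrite ltnn.
apply: allpairs_uniq; [exact: uniq_words|exact: enum_uniq|].
by move=> [? ?] [? ?].
Qed.

(** Distributivity turns the sum over words of i letters into the i-th power of the sum over
    letters. *)
Lemma sum_indexes (A : comNzRingType) (F : seq 'I_N * 'I_K -> A) (om : 'I_N -> A) (ga : 'I_K -> A) a :
  (forall w k, F (w, k) = (\prod_(j <- w) om j) * ga k) ->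
  \sum_(x <- indexes a) F x = \sum_(i < a) (\sum_j om j) ^+ i * \sum_k ga k.
Proof.
move=> FE.
have sw i : \sum_(w <- words i) \prod_(j <- w) om j = (\sum_j om j) ^+ i.
  elim: i => [|i IHi]; first by rewrite big_seq1 big_nil.
  rewrite big_allpairs_dep /= exprSr -IHi mulr_suml; apply: eq_bigr => w _.
  rewrite mulr_sumr big_enum; apply: eq_bigr => j _.
  by rewrite -cats1 big_cat big_seq1.
elim: a => [|a IHa]; first by rewrite big_nil big_ord0.
rewrite /= big_cat /= IHa big_ord_recr /=; congr (_ + _).
rewrite big_allpairs_dep -sw mulr_suml; apply: eq_bigr => w _.
by rewrite big_enum mulr_sumr; apply: eq_bigr => k _; rewrite FE.
Qed.

End Words.

(** * The Dirichlet series as a geometric series *)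

Section GeometricZeta.
Variable R : realType.
Local Notation C := (R[i]^o).

Lemma Re_nbhs (a : C) (x : R) : x < complex.Re a -> \forall s \near a, x < complex.Re s.
Proof.
move=> xa; have r0 : 0 < (complex.Re a - x)%:C%C :> C by rewrite ltcR subr_gt0.
apply: filterS (near_dist a r0) => s.
have := normc_ge_Re (s - a) => h /(le_lt_trans h); rewrite ltcR raddfB /=.
by rewrite ltr_norml => /andP[+ _]; rewrite opprB ltrBlDr addrNK.
Qed.

Lemma geometric_sumE (x : C) n : (1 - x) * \sum_(i < n) x ^+ i = 1 - x ^+ n.
Proof. by rewrite -[LHS]opprK -mulNr opprB -subrX1 opprB. Qed.

Variables (p : nat) (p_pr : prime p) (mu : {measure set (padic_borel R p_pr) -> \bar R}).
Variables (mu_haar : normalized_haar mu) (N K : nat).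
Variables (Phi : 'I_N -> padic p_pr -> padic p_pr) (r : 'I_N -> R).
Variables (G : 'I_K -> set (padic p_pr)) (g : 'I_K -> R).
Hypothesis system : self_similar_system mu Phi r G g.
Variables (n : 'I_N -> nat) (m : 'I_K -> nat) (d : nat) (n' : 'I_N -> nat) (m' : 'I_K -> nat).
Hypothesis ratioE : forall j, r j = p%:R ^- n j.
Hypothesis gapE : forall k, g k = p%:R ^- m k.
Hypothesis nE : forall j, n j = (d * n' j)%N.
Hypothesis mE : forall k, m k = (d * m' k)%N.

Let q : R := p%:R ^- d.
Let q0 : 0 < q. Proof. by rewrite invr_gt0 exprn_gt0 // ltr0n prime_gt0. Qed.
Let P (s : C) : C := \sum_(k < K) cpow q s ^+ m' k.
Let Q (s : C) : C := 1 - \sum_(j < N) cpow q s ^+ n' j.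
Local Notation L := (self_similar_string Phi G).
Local Notation word := (word_map Phi).

(** Here |z^(n'_j)| = r_j^(Re s) <= r_j because 0 < r_j < 1 and Re s >= 1; the threshold 1 is where
    the assumption on the sum of the ratios applies directly. *)
Lemma sum_norm_ratio_lt1 (s : C) : 1 <= complex.Re s -> \sum_(j < N) `|cpow q s ^+ n' j| < 1.
Proof.
move=> s1; apply: (@le_lt_trans _ _ (\sum_(j < N) (r j)%:C%C)).
  apply: ler_sum => j _; rewrite -cpowX // norm_cpow lecR.
  have -> : q ^+ n' j = r j by rewrite ratioE nE exprM exprVn.
  have [_ /andP[r0 r1] _] := system_map system j.
  by rewrite -[leRHS]powRr1 ?(ltW r0) //; apply: ger_powR => //; rewrite r0 ltW.
by rewrite -rmorph_sum ltcR; exact: system_ratio_sum system.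
Qed.

Lemma zeta_denominator_neq0 (s : C) : 1 <= complex.Re s -> Q s != 0.
Proof.
move=> s1; rewrite subr_eq0; apply/eqP => h.
have : `|\sum_(j < N) cpow q s ^+ n' j| < 1 :> R[i].
  exact: le_lt_trans (ler_norm_sum _ _ _) (sum_norm_ratio_lt1 s1).
by rewrite -h normr1 ltxx.
Qed.

Lemma cpow_haar_word_generator (s : C) w k :
  cpow (fine (mu (word w @` G k))) s = (\prod_(j <- w) cpow q s ^+ n' j) * cpow q s ^+ m' k.
Proof.
rewrite (haar_word_generator mu_haar system ratioE _ (gapE k)) /=.
have -> : p%:R ^- (word_length n w + m k) = q ^+ (\sum_(j <- w) n' j + m' k) :> R.
  rewrite /q exprVn -exprM mulnDr mE big_distrr /=; congr (_ ^- (_ + _)).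
  by apply: eq_bigr => j _; rewrite nE.
by rewrite cpowX // exprD expr_sum.
Qed.

Lemma geometric_zeta_sum (s : C) : 1 <= complex.Re s ->
  (fun J : {fset set (padic p_pr)} =>
     \sum_(B <- J | B \in convex_components R L) cpow (fine (mu B)) s)
    @ totally --> (P s / Q s : C).
Proof.
move=> s1; have Qs := zeta_denominator_neq0 s1.
pose ball (wk : seq 'I_N * 'I_K) := word wk.1 @` G wk.2.
have ball_inj : injective ball.
  by move=> [w k] [v l] /(word_generator_inj system)[/= -> ->].
pose D a := [seq ball wk | wk <- indexes N K a].
(* General weights let the same identity serve for the terms and for their norms. *)
have DE (F : set (padic p_pr) -> C) om ga a :
    (forall w k, F (word w @` G k) = (\prod_(j <- w) om j) * ga k) ->
    \sum_(B <- D a) F B = \sum_(i < a) (\sum_j om j) ^+ i * \sum_k ga k.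
  by move=> FE; rewrite big_map; apply: sum_indexes => w k; exact: FE.
pose Om : C := \sum_(j < N) `|cpow q s ^+ n' j|.
pose Ga : C := \sum_(k < K) `|cpow q s ^+ m' k|.
have Om0 : 0 <= Om by apply: sumr_ge0.
have Om1 : Om < 1 := sum_norm_ratio_lt1 s1.
have Om1' : 0 < 1 - Om by rewrite subr_gt0.
have Ga0 : 0 <= Ga by apply: sumr_ge0.
have normE w k : `|cpow (fine (mu (word w @` G k))) s| =
    (\prod_(j <- w) `|cpow q s ^+ n' j|) * `|cpow q s ^+ m' k|.
  by rewrite cpow_haar_word_generator normrM normr_prod.
apply: (@cvg_totally R _ _ _ D (fun a => Om ^+ a * (Ga / (1 - Om)))).
- by move=> a; rewrite map_inj_uniq // uniq_indexes.
- move=> a B /mapP[[w k] _ ->]; rewrite inE (convex_components_string system ratioE).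
  by exists w, k.
- move=> a b ab B /mapP[[w k] wa ->]; apply/mapP; exists (w, k) => //.
  by move: wa; rewrite !mem_indexes => /leq_trans; apply.
- move=> B; rewrite inE (convex_components_string system ratioE) => -[w [k ->]].
  by exists (size w).+1; apply/mapP; exists (w, k) => //; rewrite mem_indexes.
(* The geometric sum from a to b - 1 is at most the full tail Om^a Ga / (1 - Om). *)
- move=> a b ab; rewrite !(DE _ _ _ _ normE) -/Om -/Ga -!mulr_suml -mulrBl.
  rewrite mulrCA mulrC ler_wpM2l // ler_pdivlMr // mulrC mulrBr !geometric_sumE.
  by rewrite opprB addrC addrA subrK gerBl exprn_ge0.
- rewrite -[X in _ --> X](mul0r (Ga / (1 - Om))); apply: cvgM; last exact: cvg_cst.
  by apply: cvg_complexX; rewrite ger0_norm.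
under [X in X @ _]eq_fun do rewrite (DE _ _ _ _ (cpow_haar_word_generator s)) -mulr_suml mulrC.
apply: cvgM; first exact: cvg_cst.
set x := \sum_(j < N) _; have Q1x : Q s = 1 - x by [].
have x1 : `|x| < 1 by exact: le_lt_trans (ler_norm_sum _ _ _) Om1.
have -> : (fun a => \sum_(i < a) x ^+ i) = (fun a => (1 - x ^+ a) * (Q s)^-1).
  by apply/funext => a; rewrite -geometric_sumE mulrC -Q1x mulKf.
rewrite -[X in _ --> X]mul1r; apply: cvgM; last exact: cvg_cst.
rewrite -[X in _ --> X]subr0; apply: cvgB; [exact: cvg_cst|exact: cvg_complexX].
Qed.

Lemma meromorphic_zeta_quotient :
  exists2 f, meromorphic f & forall a, Q a != 0 -> analytic_at f a /\ f a = P a / Q a.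
Proof.
apply: meromorphic_quotient => [a|a|].
- by apply: analytic_sum => k; apply: analyticX; exact: analytic_cpow.
- apply: analyticD; first exact: analytic_cst.
  by apply: analyticN; apply: analytic_sum => j; apply: analyticX; exact: analytic_cpow.
by exists 1; apply: zeta_denominator_neq0.
Qed.

End GeometricZeta.

Theorem theorem4p14 (R : realType) (p : nat) (p_pr : prime p)
  (mu : {measure set (padic_borel R p_pr) -> \bar R})
  (mu_haar : normalized_haar mu)
  (N K : nat) (Phi : 'I_N -> padic p_pr -> padic p_pr) (r : 'I_N -> R)
  (G : 'I_K -> set (padic p_pr)) (g : 'I_K -> R)
  (system : self_similar_system mu Phi r G g)
  (n : 'I_N -> nat) (n_gt0 : forall j, (0 < n j)%N)
  (ratioE : forall j, r j = p%:R ^- n j)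
  (m : 'I_K -> nat) (m_gt0 : forall k, (0 < m k)%N)
  (gapE : forall k, g k = p%:R ^- m k)
  (d : nat)
  (dE : d = gcdn (\big[gcdn/0%N]_(j < N) n j) (\big[gcdn/0%N]_(k < K) m k))
  (n' : 'I_N -> nat) (n'_gt0 : forall j, (0 < n' j)%N)
  (nE : forall j, n j = (d * n' j)%N)
  (m' : 'I_K -> nat) (m'_gt0 : forall k, (0 < m' k)%N)
  (mE : forall k, m k = (d * m' k)%N) :
  let L := self_similar_string Phi G in
  (exists zeta : R[i]^o -> R[i]^o, is_geometric_zeta mu L zeta) /\
  (forall zeta : R[i]^o -> R[i]^o, is_geometric_zeta mu L zeta ->
    forall s : R[i]^o, let z : R[i] := cpow (p%:R ^- d) s in
      1 - \sum_(j < N) z ^+ n' j != 0 ->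
      zeta s = (\sum_(k < K) z ^+ m' k) / (1 - \sum_(j < N) z ^+ n' j)).
Proof.
move=> L; have [f mf fPQ] := meromorphic_zeta_quotient system m' ratioE nE.
have fsum (s : R[i]^o) : 1 <= complex.Re s ->
    (fun J : {fset set (padic p_pr)} =>
       \sum_(B <- J | B \in convex_components R L) cpow (fine (mu B)) s) @ totally --> f s.
  move=> s1; have [_ ->] := fPQ _ (zeta_denominator_neq0 system ratioE nE s1).
  exact: (geometric_zeta_sum mu_haar system ratioE gapE nE mE s1).
split; first by exists f; split=> //; exists 1 => s /ltW; exact: fsum.
move=> zeta [mz [sigma zsum]] s z Qs.
have [fan <-] := fPQ _ Qs.
(* Around a = max(sigma, 1) + 1 both half-planes of convergence are available, so zeta and f are
   limits of the same sums there. *)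
pose x := Num.max sigma 1; pose a : R[i]^o := (x + 1)%:C%C.
apply: (@meromorphic_unique _ zeta f a) => //.
have xa : x < complex.Re a by rewrite ltrDl.
apply: filterS (Re_nbhs xa) => t; rewrite gt_max => /andP[st t1].
have FT := @totally_filter (set (padic p_pr)).
exact: cvg_unique (zsum _ st) (fsum _ (ltW t1)).
Qed.
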